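(* Let $(v,p,h)$ be a sufficiently smooth and decaying solution of the free boundary Euler equations with gravity, and define $\psi,v_\omega,\varphi,V_\omega,B_\omega,U_\omega$ and $G(h)$ as in the context. Then: (1) On $\mathbb{R}^2$, $\partial_1U^2_\omega-\partial_2U^1_\omega=\big(\omega^3-\partial_1h\,\omega^1-\partial_2h\,\omega^2\big)\big|_{\partial\mathcal{D}_t}=\sqrt{1+|\nabla h|^2}\,(\omega\cdot n)\big|_{\partial\mathcal{D}_t}$. In particular, if $\omega\cdot n=0$ on $\partial\mathcal{D}_t$, then $U_\omega=\nabla a_\omega$ for a function $a_\omega:\mathbb{R}^2\to\mathbb{R}$. (2) Suppose $\omega\cdot n=0$ on $\partial\mathcal{D}_t$ for all $t$ in the interval considered. Then $\partial_th=G(h)\varphi$, and, with $a_\omega(t)$ as in (1) (normalized by a suitable choice of its additive constant at each time), $$\partial_t(\varphi+a_\omega)=-h-\frac12|\nabla\varphi|^2+\frac12\frac{(G(h)\varphi+\nabla h\cdot\nabla\varphi)^2}{1+|\nabla h|^2}+R_\omega,$$ where $R_\omega=-\frac12|V_\omega|^2-\nabla\varphi\cdot V_\omega-\frac12(V_\omega\cdot\nabla h)^2+(G(h)\varphi)\,V_\omega\cdot\nabla h$.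
   Context: Free boundary Euler equations with gravity: $\mathcal{D}_t=\{(x,y):x\in\mathbb{R}^2,\ y\le h(t,x)\}\subset\mathbb{R}^3$; $(\partial_t+v^k\partial_k)v_i=-\partial_ip-\delta_{i3}$, $\partial_iv^i=0$ in $\mathcal{D}_t$; $\partial_th+v^1\partial_1h+v^2\partial_2h=v^3$ and $p=0$ on $\partial\mathcal{D}_t$. $\omega=(\omega^1,\omega^2,\omega^3)=\operatorname{curl}v$ (so $\omega^3=\partial_1v^2-\partial_2v^1$, etc.). $n=(-\nabla h,1)/\sqrt{1+|\nabla h|^2}$ is the outward unit normal to $\partial\mathcal{D}_t$, $\nabla=(\partial_1,\partial_2)$ on $\mathbb{R}^2$. Let $\psi\in L^6(\mathcal{D}_t)\cap\dot H^1(\mathcal{D}_t)$ be the solution of $\Delta\psi=0$ in $\mathcal{D}_t$, $\nabla_n\psi=v\cdot n$ on $\partial\mathcal{D}_t$; $v_\omega=v-\nabla_{x,y}\psi$ (so $\operatorname{curl}v_\omega=\omega$, $\operatorname{div}v_\omega=0$, $v_\omega\cdot n=0$ on $\partial\mathcal{D}_t$); $\varphi(x)=\psi(x,h(x))$, $V_\omega^i(x)=v_\omega^i(x,h(x))$ for $i=1,2$, $B_\omega(x)=v_\omega^3(x,h(x))$, $U_\omega=V_\omega+\nabla h\,B_\omega$. The rescaled Dirichlet-to-Neumann operator is $G(h)F=\sqrt{1+|\nabla h|^2}\,(\nabla_nf)|_{\partial\mathcal{D}_t}$, where $f$ is the harmonic extension of $F$ to $\mathcal{D}_t$. *)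

(* Defs.v *)
(* R : realType, points of R^3 are ((x1,x2),y) : (R*R)*R,
   points of R^2 are (x1,x2) : R*R.  Indices 1,2,3 of the paper are the ordinals
   0,1,2 here (i0,i1,i2 in 'I_3 and j0,j1 in 'I_2). *)
From HB Require Import structures.
From mathcomp Require Import all_boot all_order all_algebra.
From mathcomp Require Import all_classical all_reals all_analysis.
From Stdlib Require Import ClassicalEpsilon.
Set Implicit Arguments. Unset Strict Implicit. Unset Printing Implicit Defensive.
Import Order.TTheory GRing.Theory Num.Theory.
Import numFieldNormedType.Exports.
Local Open Scope ring_scope.
Local Open Scope classical_set_scope.

Definition i0 : 'I_3 := @Ordinal 3 0 isT.
Definition i1 : 'I_3 := @Ordinal 3 1 isT.
Definition i2 : 'I_3 := @Ordinal 3 2 isT.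
Definition j0 : 'I_2 := @Ordinal 2 0 isT.
Definition j1 : 'I_2 := @Ordinal 2 1 isT.
Definition jto3 (j : 'I_2) : 'I_3 := widen_ord (isT : (2 <= 3)%N) j.

Definition e3 {R : realType} (i : 'I_3) : (R * R) * R :=
  if val i == 0%N then (1, 0, 0) else if val i == 1%N then (0, 1, 0) else (0, 0, 1).
Definition e2 {R : realType} (j : 'I_2) : R * R :=
  if val j == 0%N then (1, 0) else (0, 1).

Definition pd3 {R : realType} (i : 'I_3) (f : (R * R) * R -> R) (p : (R * R) * R) : R :=
  derive f p (e3 i).
Definition pd2 {R : realType} (j : 'I_2) (g : R * R -> R) (x : R * R) : R :=
  derive g x (e2 j).
Definition dt {R : realType} {T : Type} (f : R -> T -> R) (t : R) (y : T) : R :=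
  derive (fun s : R => f s y) t 1.

Fixpoint Ck {R : realType} {V : normedModType R} (k : nat) (f : V -> R) : Prop :=
  match k with
  | 0%N => continuous f
  | k'.+1 => (forall x, differentiable f x) /\ (forall u : V, Ck k' (fun x => derive f x u))
  end.
Definition smooth {R : realType} {V : normedModType R} (f : V -> R) : Prop :=
  forall k, Ck k f.
Definition smooth_t {R : realType} {V : normedModType R} (f : R -> V -> R) : Prop :=
  smooth (fun tp : R * V => f tp.1 tp.2).

Definition Dom {R : realType} (h : R * R -> R) : set ((R * R) * R) :=
  [set p | p.2 <= h p.1].

Definition lap {R : realType} (f : (R * R) * R -> R) (p : (R * R) * R) : R :=
  \sum_(i < 3) pd3 i (pd3 i f) p.

Definition gradsq2 {R : realType} (g : R * R -> R) (x : R * R) : R :=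
  pd2 j0 g x ^+ 2 + pd2 j1 g x ^+ 2.

(* outward unit normal n = (-grad h, 1)/sqrt(1+|grad h|^2) at (x, h x) *)
Definition nrm {R : realType} (h : R * R -> R) (x : R * R) (i : 'I_3) : R :=
  (if val i == 2%N then 1 else - pd2 (inord (val i)) h x) / Num.sqrt (1 + gradsq2 h x).

Definition ndir {R : realType} (h : R * R -> R) (f : (R * R) * R -> R) (x : R * R) : R :=
  \sum_(i < 3) nrm h x i * pd3 i f (x, h x).

Definition leb3 {R : realType} :=
  ((@lebesgue_measure R \x @lebesgue_measure R) \x @lebesgue_measure R)%E.

Definition L6 {R : realType} (D : set ((R * R) * R)) (f : (R * R) * R -> R) : Prop :=
  (\int[leb3]_(p in D) ((f p) ^+ 6)%:E < +oo)%E.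
Definition Hdot1 {R : realType} (D : set ((R * R) * R)) (f : (R * R) * R -> R) : Prop :=
  (\int[leb3]_(p in D) (\sum_(i < 3) (pd3 i f p) ^+ 2)%:E < +oo)%E.

Definition is_harm_ext {R : realType} (h : R * R -> R) (F : R * R -> R)
    (f : (R * R) * R -> R) : Prop :=
  smooth f /\ (forall p, Dom h p -> lap f p = 0) /\ (forall x, f (x, h x) = F x) /\
  L6 (Dom h) f /\ Hdot1 (Dom h) f.

Definition DtN {R : realType} (h : R * R -> R) (F : R * R -> R) (x : R * R) : R :=
  Num.sqrt (1 + gradsq2 h x) *
  ndir h (epsilon (inhabits (fun _ : (R * R) * R => (0 : R))) (is_harm_ext h F)) x.

Definition curl {R : realType} (u : 'I_3 -> (R * R) * R -> R) (i : 'I_3) (p : (R * R) * R) : R :=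
  if val i == 0%N then pd3 i1 (u i2) p - pd3 i2 (u i1) p
  else if val i == 1%N then pd3 i2 (u i0) p - pd3 i0 (u i2) p
  else pd3 i0 (u i1) p - pd3 i1 (u i0) p.

Section FreeBoundary.
Context {R : realType} (v : 'I_3 -> R -> (R * R) * R -> R) (psi : R -> (R * R) * R -> R)
  (h : R -> R * R -> R).

Definition omega (t : R) : 'I_3 -> (R * R) * R -> R := curl (fun i => v i t).
Definition omega_n (t : R) (x : R * R) : R :=
  \sum_(i < 3) omega t i (x, h t x) * nrm (h t) x i.
Definition phi (t : R) (x : R * R) : R := psi t (x, h t x).
Definition vom (i : 'I_3) (t : R) (p : (R * R) * R) : R := v i t p - pd3 i (psi t) p.
Definition Vom (j : 'I_2) (t : R) (x : R * R) : R := vom (jto3 j) t (x, h t x).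
Definition Bom (t : R) (x : R * R) : R := vom i2 t (x, h t x).
Definition Uom (j : 'I_2) (t : R) (x : R * R) : R := Vom j t x + pd2 j (h t) x * Bom t x.
Definition Rom (t : R) (x : R * R) : R :=
  - (1 / 2) * (Vom j0 t x ^+ 2 + Vom j1 t x ^+ 2)
  - (pd2 j0 (phi t) x * Vom j0 t x + pd2 j1 (phi t) x * Vom j1 t x)
  - (1 / 2) * (Vom j0 t x * pd2 j0 (h t) x + Vom j1 t x * pd2 j1 (h t) x) ^+ 2
  + DtN (h t) (phi t) x * (Vom j0 t x * pd2 j0 (h t) x + Vom j1 t x * pd2 j1 (h t) x).
End FreeBoundary.

(* Main.v *)
(* For fixed t all quantities on the surface are traces F(t, (x, h(t, x))), so that
   ∂_j of a trace is the trace of ∂_j F + ∂_j h ∂_3 F. Since ∇ψ drops out of curls, part (1)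
   is this chain rule plus symmetry of second derivatives, and Poincaré's lemma.

   In part (2) put P_j = (v_j + ∂_j h v_3)| = U_ω^j + ∂_j φ. The right-hand side of the evolution
   equation is algebraically Q = - h - |v|^2/2 + v_3 ∂_t h, and the Euler equations with p = 0 on
   the surface and ω.n = 0 say exactly that Q dt + P_1 dx_1 + P_2 dx_2 is closed on the slab
   ]T0, T1[ x R^2. If A is a potential of this form, a := A - φ is the required function.

   The Dirichlet-to-Neumann operator is defined by choosing some harmonic extension, so that
   G(h)φ = sqrt(1 + |∇h|^2) ∇_n ψ needs uniqueness of that extension. If u is the difference of two
   extensions, w = u^6 extended by 0 outside the domain is C^2 on R^3, integrable, with
   Δw = 30 u^4 |∇u|^2 >= 0 inside. Testing with a cutoff χ at scale r gives
   ∫ χ Δw = ∫ w Δχ = O(r^-2), hence u ∇u = 0. *)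
Require Import Defs.
From HB Require Import structures.
From mathcomp Require Import all_boot all_order all_algebra.
From mathcomp Require Import all_classical all_reals all_analysis.
From Stdlib Require ClassicalEpsilon.
From mathcomp Require Import measurable_realfun ring lra.
Set Implicit Arguments. Unset Strict Implicit. Unset Printing Implicit Defensive.
Import Order.TTheory GRing.Theory Num.Theory.
Import numFieldNormedType.Exports.
Local Open Scope ring_scope.
Local Open Scope classical_set_scope.

(** * Directional derivatives *)

(** The power 6 serves two ends: membership in L^6 makes u^6 integrable, and any power of at least 3
    vanishes on the boundary together with its first and second derivatives, so that u^6 extends by
    zero to a C^2 function whatever the surface looks like. No trace theorem and no surface integral
    is then needed: all integration by parts takes place in the whole space, one coordinate at a
    time. The fields are smooth on all of R^3 while the equations hold only below the surface. Two
    harmonic extensions may therefore differ above it, and their derivatives at the surface have to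
    be compared by continuity from below. The closed form is built from v, since v is the field that
    the Euler equations govern. Its potential is sought on the whole slab rather than at each time
    separately: potentials chosen time by time would leave an arbitrary function of t and no
    regularity in t, whereas integration from one fixed point of space-time settles both, and with
    them the normalization of a_ω. *)

Lemma quotient_eq (R : realType) (U V : normedModType R) (f : U -> R) (g : V -> R) x y u w :
  (forall k : R, f (k *: u + x) = g (k *: w + y)) ->
  (fun k : R => k^-1 *: ((f \o shift x) (k *: u) - f x)) =
  (fun k : R => k^-1 *: ((g \o shift y) (k *: w) - g y)).
Proof.
move=> E; have E0 : f x = g y by have := E 0; rewrite !scale0r !add0r.
by apply/funext => k /=; rewrite E E0.
Qed.

(** Both derivatives are the limit of one and the same quotient, so they agree even where that limit
    does not exist; no differentiability has to be assumed. *)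
Lemma derive_eq_quotient (R : realType) (U V : normedModType R) (f : U -> R) (g : V -> R) x y u w :
  (forall k : R, f (k *: u + x) = g (k *: w + y)) -> derive f x u = derive g y w.
Proof. by rewrite /derive => /quotient_eq ->. Qed.

Lemma derivable_eq_quotient (R : realType) (U V : normedModType R) (f : U -> R) (g : V -> R) x y u w :
  (forall k : R, f (k *: u + x) = g (k *: w + y)) -> derivable f x u -> derivable g y w.
Proof. by rewrite /derivable => /quotient_eq ->. Qed.

Section Calculus.
Context {R : realType} {V : normedModType R}.
Implicit Types (f g : V -> R) (x z u w : V).

Lemma derive_comb f x (a b : R) u w : differentiable f x ->
  derive f x (a *: u + b *: w) = a * derive f x u + b * derive f x w.
Proof. by move=> df; rewrite !deriveE// linearD !linearZ. Qed.

Lemma is_derive_line f z u (s : R) : differentiable f (z + s *: u) ->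
  is_derive s 1 (fun r : R => f (z + r *: u)) (derive f (z + s *: u) u).
Proof.
move=> df.
have dl : is_diff s (fun r : R => z + r *: u) (fun r : R => r *: u).
  have dZ : differentiable (fun r : R => r *: u) s by exact: differentiableZl.
  apply: DiffDef; first by apply: differentiableD.
  apply/funext => r.
  rewrite (@diffD _ _ _ (cst z) (fun r : R => r *: u)) //= diff_cst diffZl //=.
  by rewrite diff_val /= add0r.
have dc : differentiable (f \o (fun r : R => z + r *: u)) s.
  by apply: differentiable_comp; [exact: ex_diff|exact: df].
apply: DeriveDef; first exact: diff_derivable.
rewrite deriveE // diff_comp //= diff_val /= scale1r deriveE //.
Qed.

Lemma line_continuous z u : continuous (fun r : R => z + r *: u).
Proof.
move=> r; apply: cvgD; first exact: cvg_cst.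
by apply: cvgZr_tmp; exact: cvg_id.
Qed.

Lemma line_MVT f z u (s : R) : 0 < s -> (forall x, differentiable f x) ->
  exists2 r, r \in `]0, s[%R & f (z + s *: u) - f z = s * derive f (z + r *: u) u.
Proof.
move=> s0 df.
have cf : continuous (fun r : R => f (z + r *: u)).
  by move=> r; apply: continuous_comp; [exact: line_continuous|exact: differentiable_continuous].
have [r rI E] := @MVT R (fun r : R => f (z + r *: u)) (fun r => derive f (z + r *: u) u) 0 s s0
  (fun r _ => is_derive_line (df _)) (continuous_subspaceT cf).
by exists r => //; move: E; rewrite scale0r addr0 subr0 mulrC.
Qed.

(** The mean value theorem is applied to the increment of [f] in direction [w], moving along [u],
    and then to the [u]-derivative, moving along [w]. One step [s] for both directions keeps the
    second difference symmetric in [u] and [w]. *)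
Lemma second_difference_MVT f x u w (s : R) : 0 < s -> Ck 2 f ->
  exists r r', [/\ 0 <= r <= s, 0 <= r' <= s &
   f (x + s *: u + s *: w) - f (x + s *: u) - (f (x + s *: w) - f x)
   = s ^+ 2 * derive (fun y => derive f y u) (x + r *: u + r' *: w) w].
Proof.
move=> s0 [df dd].
pose g y := f (y + s *: w) - f y.
have dsh y : differentiable (fun y => f (y + s *: w)) y.
  have ds : differentiable (id + cst (s *: w)) y by exact: ex_diff.
  exact: (@differentiable_comp _ _ _ _ (id + cst (s *: w)) f).
have dg y : differentiable g y by apply: differentiableB.
have [r rI E] := line_MVT x u s0 dg.
have [r' rI' E'] := line_MVT (x + r *: u) w s0 (dd u).1.
exists r, r'; split.
- by move: rI; rewrite in_itv/= => /andP[/ltW-> /ltW->].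
- by move: rI'; rewrite in_itv/= => /andP[/ltW-> /ltW->].
have E2 : derive g (x + r *: u) u =
   derive f (x + r *: u + s *: w) u - derive f (x + r *: u) u.
  rewrite -[g]/((fun y => f (y + s *: w)) - f) deriveB;
    [|apply: diff_derivable; exact: dsh|apply: diff_derivable; exact: df].
  by congr (_ - _); apply: derive_eq_quotient => k; rewrite -!addrA.
by rewrite -[LHS]/(g (x + s *: u) - g x) E E2 E' expr2 mulrA.
Qed.

(** The symmetric second difference is s^2 times either mixed derivative, each at some point near
    [x]; continuity of both at [x] then forces equality there. *)
Lemma Schwarz f x u w : Ck 2 f ->
  derive (fun y => derive f y u) x w = derive (fun y => derive f y w) x u.
Proof.
move=> f2; have [_ dd] := f2.
pose A := fun y => derive (fun y => derive f y u) y w.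
pose B := fun y => derive (fun y => derive f y w) y u.
rewrite -[LHS]/(A x) -[RHS]/(B x).
have cA : continuous A by exact: (dd u).2.
have cB : continuous B by exact: (dd w).2.
apply/eqP; rewrite -subr_eq0 -normr_le0; apply/ler_addgt0Pr => e e0; rewrite add0r.
have e20 : 0 < e / 2 by rewrite divr_gt0.
have [d d0 Hd] : exists2 d : R, 0 < d & forall y, `|x - y| < d ->
    `|A x - A y| < e / 2 /\ `|B x - B y| < e / 2.
  have /cvgrPdist_lt/(_ _ e20)/nbhs_normP[d1 /= d10 H1] := cA x.
  have /cvgrPdist_lt/(_ _ e20)/nbhs_normP[d2 /= d20 H2] := cB x.
  exists (Num.min d1 d2); first by rewrite lt_min d10.
  by move=> y; rewrite lt_min => /andP[y1 y2]; split; [exact: H1|exact: H2].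
(* This size keeps both intermediate points within [d] of [x]; the 1 keeps the denominator positive
   when [u] and [w] vanish. *)
pose s := d / (1 + `|u| + `|w|).
have n0 : 0 < 1 + `|u| + `|w| by rewrite -addrA ltr_pwDl// addr_ge0.
have s0 : 0 < s by rewrite divr_gt0.
have small r r' : 0 <= r <= s -> 0 <= r' <= s -> `|x - (x + r *: u + r' *: w)| < d.
  move=> /andP[r0 rs] /andP[r'0 r's].
  rewrite -addrA opprD addrA subrr add0r normrN.
  apply: le_lt_trans (ler_normD _ _) _; rewrite !normrZ !ger0_norm//.
  apply: (@le_lt_trans _ _ (s * (`|u| + `|w|))).
    by rewrite mulrDr lerD// ler_wpM2r.
  rewrite /s mulrAC ltr_pdivrMr// ltr_pM2l//; lra.
have [r [r' [rs r's E]]] := second_difference_MVT x u w s0 f2.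
have [t [t' [ts t's E']]] := second_difference_MVT x w u s0 f2.
have AB : A (x + r *: u + r' *: w) = B (x + t' *: u + t *: w).
  have s2 : s ^+ 2 != 0 by rewrite expf_neq0// gt_eqF.
  apply: (mulfI s2).
  apply: (etrans (esym E)); rewrite (addrAC x (t' *: u)); apply: etrans E'.
  by rewrite (addrAC x (s *: u)) !opprD !opprK addrACA [- f _ + _]addrC -addrACA.
have [HA _] := Hd _ (small _ _ rs r's).
have [_ HB] := Hd _ (small _ _ t's ts).
rewrite (_ : A x - B x = (A x - A (x + r *: u + r' *: w)) -
  (B x - B (x + t' *: u + t *: w))); last first.
  by rewrite AB opprB addrA subrK.
apply: le_trans (ler_normB _ _) _; rewrite (splitr e); apply: lerD; [exact: ltW HA|exact: ltW HB].
Qed.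

End Calculus.

(** * Closure properties of C^k and smooth functions *)

Section C1.
Context {R : realType} {V : normedModType R}.
Implicit Types (f g : V -> R).

Lemma C1_continuous f : Ck 1 f -> continuous f.
Proof. by move=> [df _] x; exact: differentiable_continuous. Qed.

Lemma C1_cst (c : R) : Ck 1 (fun _ : V => c).
Proof.
split=> [x|u x]; first exact: differentiable_cst.
have -> : (fun x : V => derive (fun=> c) x u) = cst 0.
  by apply/funext => y; exact: derive_cst.
exact: cst_continuous.
Qed.

Lemma C1D f g : Ck 1 f -> Ck 1 g -> Ck 1 (fun x => f x + g x).
Proof.
move=> [df cf] [dg cg]; split=> [x|u x]; first exact: differentiableD.
have -> : (fun x => derive (fun x => f x + g x) x u) =
          (fun x => derive f x u + derive g x u).
  by apply/funext => y; rewrite -deriveD//; exact: diff_derivable.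
by apply: cvgD; [exact: cf|exact: cg].
Qed.

Lemma C1M f g : Ck 1 f -> Ck 1 g -> Ck 1 (fun x => f x * g x).
Proof.
move=> Cf Cg; have [df cf] := Cf; have [dg cg] := Cg.
split=> [x|u x]; first exact: differentiableM.
have -> : (fun x => derive (fun x => f x * g x) x u) =
          (fun x => f x * derive g x u + g x * derive f x u).
  by apply/funext => y; rewrite -deriveM//; exact: diff_derivable.
by apply: cvgD; apply: cvgM; [exact: C1_continuous|exact: cg|exact: C1_continuous|exact: cf].
Qed.

Lemma CkB k f g : Ck k f -> Ck k g -> Ck k (fun x => f x - g x).
Proof.
elim: k f g => [|k IH] f g /=; first by move=> cf cg x; apply: cvgB; [exact: cf|exact: cg].
move=> [df cf] [dg cg]; split=> [x|u]; first exact: differentiableB.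
have -> : (fun x => derive (fun x => f x - g x) x u) =
          (fun x => derive f x u - derive g x u).
  by apply/funext => y; rewrite -deriveB//; exact: diff_derivable.
by apply: IH; [exact: cf|exact: cg].
Qed.

Lemma smooth_derive f u : smooth f -> smooth (fun x => derive f x u).
Proof. by move=> sf k; exact: (sf k.+1).2. Qed.

Lemma smooth_differentiable f : smooth f -> forall x, differentiable f x.
Proof. by move=> sf; exact: (sf 1%N).1. Qed.

Lemma smooth_continuous f : smooth f -> continuous f.
Proof. by move=> sf; exact: (sf 0%N). Qed.

End C1.

(** * Restriction of a function to the graph of a moving surface *)

Section Graph.
Context {R : realType} {A B : normedModType R}.
Variables (F : A * (B * R) -> R) (H : A * B -> R).

(** In the application [A] is the time axis and [B] the plane, and this is (t, x) -> (t, (x, h(t,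
    x))). *)
Definition graph_map (z : A * B) : A * (B * R) := (z.1, (z.2, H z)).
Definition on_graph (z : A * B) : R := F (graph_map z).

Lemma fst_diff (U W : normedModType R) (z : U * W) : is_diff z fst fst.
Proof.
pose L : {linear (U * W)%type -> U} := fst.
have cL : continuous L by move=> p; exact: cvg_fst.
by apply: DiffDef; [exact: (linear_differentiable z cL)|exact: (diff_lin z cL)].
Qed.

Lemma snd_diff (U W : normedModType R) (z : U * W) : is_diff z snd snd.
Proof.
pose L : {linear (U * W)%type -> W} := snd.
have cL : continuous L by move=> p; exact: cvg_snd.
by apply: DiffDef; [exact: (linear_differentiable z cL)|exact: (diff_lin z cL)].
Qed.

Hypothesis dH : forall z, differentiable H z.

Lemma graph_map_diff z : is_diff z graph_map (fun e => (e.1, (e.2, 'd H z e))).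
Proof.
have [d1 e1] := fst_diff z; have [d2 e2] := snd_diff z.
have d3 : differentiable (fun z => (z.2, H z)) z by apply: differentiable_pair.
apply: DiffDef; first exact: differentiable_pair.
apply/funext => e.
rewrite /graph_map diff_pair //= diff_pair //=.
by rewrite e1 e2.
Qed.

Hypothesis dF : forall q, differentiable F q.

Lemma on_graph_differentiable z : differentiable on_graph z.
Proof.
have [dg eg] := graph_map_diff z.
exact: (@differentiable_comp _ _ _ _ graph_map F).
Qed.

Lemma on_graph_derive z a b : derive on_graph z (a, b) =
  derive F (graph_map z) (a, (b, 0)) + derive H z (a, b) * derive F (graph_map z) (0, (0, 1)).
Proof.
have [dg eg] := graph_map_diff z.
rewrite !deriveE //; last exact: on_graph_differentiable.
rewrite (@diff_comp _ _ _ _ graph_map F) //=.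
rewrite eg /=.
have -> : (a, (b, 'd H z (a, b))) = (a, (b, 0)) + 'd H z (a, b) *: (0, (0, 1)) :> A * (B * R).
  by congr (_, (_, _)); rewrite /= ?scaler0 ?addr0 // add0r [_ *: _]mulr1.
by rewrite linearD linearZ.
Qed.

Lemma on_graph_continuous : continuous on_graph.
Proof. by move=> z; exact/differentiable_continuous/on_graph_differentiable. Qed.

End Graph.

(** First derivatives of a trace are again combinations of traces, by [on_graph_derive]. Class C^1
    is what the coefficients of a form need in the Poincaré lemma. *)
Lemma C1_on_graph (R : realType) (A B : normedModType R) (F : A * (B * R) -> R) (H : A * B -> R) :
  smooth F -> smooth H -> Ck 1 (on_graph F H).
Proof.
move=> sF sH; have dF := smooth_differentiable sF; have dH := smooth_differentiable sH.
split=> [z|[a b] z]; first exact: on_graph_differentiable.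
have -> : (fun z => derive (on_graph F H) z (a, b)) = (fun z =>
   on_graph (fun q => derive F q (a, (b, 0))) H z +
   derive H z (a, b) * on_graph (fun q => derive F q (0, (0, 1))) H z).
  by apply/funext => y; rewrite on_graph_derive.
have sD u : smooth (fun q => derive F q u) by exact: smooth_derive.
apply: cvgD; first exact: (on_graph_continuous dH (smooth_differentiable (sD _))).
apply: cvgM; first exact: (smooth_continuous (smooth_derive _ sH)).
exact: (on_graph_continuous dH (smooth_differentiable (sD _))).
Qed.

(** * Integration in one variable and the Poincaré lemma *)

Lemma compact_bound (R : realType) (T : topologicalType) (f : T -> R) (K : set T) :
  compact K -> continuous f -> exists2 M, 0 <= M & forall x, K x -> `|f x| <= M.
Proof.
move=> cK cf; have [->|K0] := eqVneq K set0; first by exists 0.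
have cn : continuous (fun x => `|f x|) by move=> x; apply: cvg_norm; exact: cf.
move: K0 => /set0P K0.
have [c _ Hc] := compact_EVT_max K0 cK (continuous_subspaceT cn).
by exists `|f c| => // x Kx; apply: Hc; rewrite inE.
Qed.

Lemma continuous2 (T V W U : topologicalType) (h : V -> W -> U) (f : T -> V) (g : T -> W) :
  continuous (fun p : V * W => h p.1 p.2) -> continuous f -> continuous g ->
  continuous (fun x => h (f x) (g x)).
Proof.
move=> ch cf cg x; apply: (@continuous2_cvg _ _ _ _ _ _ f g h (f x) (g x)).
- exact: (ch (f x, g x)).
- exact: cf.
- exact: cg.
Qed.

Section OneVariable.
Context {R : realType}.
Local Notation mu := (@lebesgue_measure R).

Lemma is_derive_continuous (F f : R -> R) :
  (forall x : R, is_derive x 1 F (f x)) -> continuous F.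
Proof.
move=> dF x; apply: differentiable_continuous; apply/derivable1_diffP.
by case: (dF x).
Qed.

Lemma FTC_Rintegral (F f : R -> R) (a b : R) : a < b ->
  continuous f -> (forall x : R, is_derive x 1 F (f x)) ->
  \int[mu]_(x in `[a, b]) f x = F b - F a.
Proof.
move=> ab cf dF; have cF := is_derive_continuous dF.
rewrite /Rintegral (@continuous_FTC2 _ f F) //.
- exact: continuous_subspaceT.
- split=> [x _||]; first by case: (dF x).
  + exact/cvg_at_right_filter/cF.
  + exact/cvg_at_left_filter/cF.
- by move=> x _; rewrite derive1E; case: (dF x).
Qed.

Lemma Rintegral_continuous_integrable (f : R -> R) (a b : R) :
  continuous f -> mu.-integrable `[a, b] (EFin \o f).
Proof.
move=> cf; apply: continuous_compact_integrable; first exact: segment_compact.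
exact: continuous_subspaceT.
Qed.

Lemma Leibniz_rule (g G : R -> R -> R) :
  (forall r s : R, is_derive r 1 (g ^~ s) (G r s)) ->
  continuous (fun p : R * R => g p.1 p.2) ->
  continuous (fun p : R * R => G p.1 p.2) -> forall r : R,
  is_derive r 1 (fun r => \int[mu]_(s in `[0, 1]) g r s) (\int[mu]_(s in `[0, 1]) G r s).
Proof.
move=> dg cg cG r.
have cg1 r' : continuous (g r').
  by apply: (continuous2 cg) => s; [exact: cvg_cst|exact: cvg_id].
(* A bound of [G] on a compact rectangle around [r] is the constant that dominates the derivative of
   the integrand. *)
have [M M0 HM] := compact_bound (compact_setX (@segment_compact R (r - 1) (r + 1))
  (@segment_compact R 0 1)) cG.
have Ir : `]r - 1, r + 1[%classic r by rewrite /= in_itv /=; apply/andP; split; lra.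
have I1 x : `]r - 1, r + 1[%classic x -> mu.-integrable `[0, 1] (EFin \o g x).
  by move=> _; exact: Rintegral_continuous_integrable.
have I2 x y : `]r - 1, r + 1[%classic x -> `[0, 1]%classic y -> derivable (g ^~ y) x 1.
  by move=> _ _; case: (dg x y).
have I3 : mu.-integrable `[0, 1] (EFin \o (fun _ : R => M)).
  by apply: Rintegral_continuous_integrable => x; exact: cvg_cst.
have E : partial1of2 g = G.
  by apply/funext => x; apply/funext => y; rewrite partial1of2E; case: (dg x y).
have I4 x y : `]r - 1, r + 1[%classic x -> `[0, 1]%classic y -> `|partial1of2 g x y| <= M.
  rewrite E /= in_itv /= => /andP[x1 x2] y1; apply: (HM (x, y)); split => //=.
  by rewrite in_itv /= !ltW.
have m01 : measurable (`[0, 1]%classic : set R) by [].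
apply: DeriveDef.
  exact: (@derivable_under_integral R _ _ mu g _ m01 r _ _ Ir I1 I2 _ (fun=> M0) I3 I4).
rewrite -derive1E.
by rewrite (@differentiation_under_integral R _ _ mu g _ m01 r _ _ Ir I1 I2 _ (fun=> M0) I3 I4) E.
Qed.

End OneVariable.

Section Poincare.
Context {R : realType} {V : normedModType R}.
Local Notation mu := (@lebesgue_measure R).
Variables (W : V -> V -> R) (z0 z : V).
Hypothesis Wlin : forall q a b u w, W q (a *: u + b *: w) = a * W q u + b * W q w.
Hypothesis WC1 : forall e, Ck 1 (fun q => W q e).
(** Closedness is asked only on the segment from [z0] to [z], and only for pairs containing its
    direction, so that the lemma applies to a form closed merely on a star-shaped part of [V], such
    as the slab. *)
Hypothesis Wclosed : forall (s : R) e, 0 <= s <= 1 ->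
  derive (fun q => W q (z - z0)) (z0 + s *: (z - z0)) e =
  derive (fun q => W q e) (z0 + s *: (z - z0)) (z - z0).

(* The integrand along the ray is d/ds of s W(z0 + s (z - z0)) e once closedness has
   exchanged the two directions. *)
Lemma Poincare_lemma e :
  is_derive z e (fun q => \int[mu]_(s in `[0, 1]) W (z0 + s *: (q - z0)) (q - z0)) (W z e).
Proof.
pose y := z - z0.
(* For fixed [r] this is the ray from [z0] to [z + r *: e]. Hence [g r] integrates to the candidate
   potential at [z + r *: e], and its [r]-derivative at 0 is the derivative at [z] in direction
   [e]. *)
pose gam (r s : R) := (z0 + s *: y) + r *: (s *: e).
pose g (r s : R) := W (gam r s) y + r * W (gam r s) e.
pose G (r s : R) := s * derive (fun q => W q y) (gam r s) e +
  (W (gam r s) e + r * (s * derive (fun q => W q e) (gam r s) e)).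
have cgam : continuous (fun p : R * R => gam p.1 p.2).
  move=> p; apply: cvgD; first (apply: cvgD; first exact: cvg_cst).
    by apply: cvgZ; [exact: cvg_snd|exact: cvg_cst].
  by apply: cvgZ; [exact: cvg_fst|apply: cvgZ; [exact: cvg_snd|exact: cvg_cst]].
have cW f : continuous f -> continuous (fun p : R * R => f (gam p.1 p.2) : R).
  by move=> cf p; exact: (@continuous_comp _ _ _ (fun p : R * R => gam p.1 p.2) f p (cgam p) (cf _)).
have cWe e' : continuous (fun p : R * R => W (gam p.1 p.2) e').
  exact: (cW _ (C1_continuous (WC1 e'))).
have cDe e' : continuous (fun p : R * R => derive (fun q => W q e') (gam p.1 p.2) e).
  exact: (cW _ ((WC1 e').2 e)).
have dW e' (r s : R) : is_derive r 1 (fun r => W (gam r s) e')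
    (s * derive (fun q => W q e') (gam r s) e).
  have -> : s * derive (fun q => W q e') (gam r s) e =
      derive (fun q => W q e') (gam r s) (s *: e).
    by rewrite !deriveE ?linearZ//; exact: (WC1 e').1.
  by apply: is_derive_line; exact: (WC1 e').1.
have dg (r s : R) : is_derive r 1 (g ^~ s) (G r s).
  have d1 := dW y r s; have d2 := dW e r s.
  apply: is_derive_eq; rewrite /G.
  by rewrite -![_ *: _]/(_ * _); ring.
have cg : continuous (fun p : R * R => g p.1 p.2).
  by move=> p; apply: cvgD; [exact: cWe|apply: cvgM; [exact: cvg_fst|exact: cWe]].
have cG : continuous (fun p : R * R => G p.1 p.2).
  move=> p; apply: cvgD; first by apply: cvgM; [exact: cvg_snd|exact: cDe].
  apply: cvgD; first exact: cWe.
  by apply: cvgM; [exact: cvg_fst|apply: cvgM; [exact: cvg_snd|exact: cDe]].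
have [D1 D2] := Leibniz_rule dg cg cG 0.
have E (k : R) : \int[mu]_(s in `[0, 1]) g (k *: 1 + 0) s =
   \int[mu]_(s in `[0, 1]) W (z0 + s *: (k *: e + z - z0)) (k *: e + z - z0).
  apply: eq_Rintegral => s _; rewrite addr0 [k *: 1]mulr1 /g.
  have -> : k *: e + z - z0 = 1 *: y + k *: e by rewrite scale1r /y [k *: e + z]addrC addrAC.
  have -> : gam k s = z0 + s *: (1 *: y + k *: e).
    by rewrite /gam scale1r [s *: (y + _)]scalerDr addrA !scalerA [s * k]mulrC.
  by rewrite Wlin mul1r.
apply: DeriveDef; first exact: (derivable_eq_quotient E D1).
have <- : derive (fun r : R => \int[mu]_(s in `[0, 1]) g r s) 0 1 =
    derive (fun q => \int[mu]_(s in `[0, 1]) W (z0 + s *: (q - z0)) (q - z0)) z e.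
  exact: derive_eq_quotient E.
rewrite D2.
have dF (s : R) : is_derive s 1 (fun s => s * W (z0 + s *: y) e)
    (s * derive (fun q => W q e) (z0 + s *: y) y + W (z0 + s *: y) e).
  have dl := @is_derive_line _ _ (fun q => W q e) z0 y s ((WC1 e).1 _).
  by apply: is_derive_eq; rewrite [_%:A]mulr1.
have cF : continuous (fun s : R => s * derive (fun q => W q e) (z0 + s *: y) y + W (z0 + s *: y) e).
  move=> s; have cl := @line_continuous _ _ z0 y s.
  apply: cvgD; first apply: cvgM; first exact: cvg_id.
    exact: (@continuous_comp _ _ _ _ (fun q => derive (fun q => W q e) q y) s cl ((WC1 e).2 y _)).
  exact: (@continuous_comp _ _ _ _ (fun q => W q e) s cl (@C1_continuous _ _ _ (WC1 e) _)).
have := FTC_Rintegral ltr01 cF dF.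
rewrite mul1r mul0r subr0 scale1r /y (addrC z0) subrK => <-.
apply: eq_Rintegral => s; rewrite inE /= in_itv /= => s01.
by rewrite /G /gam scale0r addr0 mul0r addr0 Wclosed.
Qed.

End Poincare.

(** * Differentiability from continuous partial derivatives *)

Section PartialDerivatives.
Context {R : realType}.
Variables (a P1 P2 : R * R -> R).
Hypotheses (cP1 : continuous P1) (cP2 : continuous P2).
Hypothesis da : forall z e, is_derive z e a (e.1 * P1 z + e.2 * P2 z).

(** The Poincaré lemma yields directional derivatives only; this upgrades them to the
    differentiability claimed for a_ω. *)
Lemma continuous_partials_differentiable x : differentiable a x.
Proof.
pose L (e : R * R) : R := e.1 * P1 x + e.2 * P2 x.
have L_lin : linear L by move=> k u w; rewrite /L /= -![_ *: _]/(_ * _); ring.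
pose LM := GRing.isLinear.Build _ _ _ _ _ L_lin.
pose LL : {linear (R * R)%type -> R} := HB.pack L LM.
have cL : continuous LL.
  by move=> p; apply: cvgD; apply: cvgM; [exact: cvg_fst|exact: cvg_cst|exact: cvg_snd|exact: cvg_cst].
have norm1 (e : R * R) : `|e.1| <= `|e| by rewrite prod_normE le_max lexx.
have norm2 (e : R * R) : `|e.2| <= `|e| by rewrite prod_normE le_max lexx orbT.
have o : a \o shift x = cst (a x) + LL +o_ 0 id.
  apply/eqaddoP => eps eps0.
  suff : \forall e \near (0 : R * R), `|a (e + x) - (a x + L e)| <= eps * `|e| by [].
  apply/nbhs_normP.
  have e20 : 0 < eps / 2 by rewrite divr_gt0.
  have /cvgrPdist_lt/(_ _ e20)/nbhs_normP[d1 /= d10 H1] := @cP1 x.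
  have /cvgrPdist_lt/(_ _ e20)/nbhs_normP[d2 /= d20 H2] := @cP2 x.
  exists (Num.min d1 d2); first by rewrite /= lt_min d10.
  move=> e; rewrite /= sub0r normrN lt_min => /andP[e1 e2].
  have dl (s : R) : is_derive s 1 (fun s : R => a (x + s *: e))
      (e.1 * P1 (x + s *: e) + e.2 * P2 (x + s *: e)).
    have Ek (k : R) : a (k *: e + (x + s *: e)) = a (x + (k *: 1 + s) *: e).
      by rewrite [k *: 1]mulr1 scalerDl addrCA.
    have [D1 D2] := da (x + s *: e) e.
    by apply: DeriveDef; [exact: (derivable_eq_quotient Ek D1)|rewrite -(derive_eq_quotient Ek)].
  (* The increment over [e] is the form at an intermediate point, where each coefficient is within
     eps/2 of its value at [x]. *)
  have [c c01 E] := MVT ltr01 (fun s _ => dl s) (continuous_subspaceT (is_derive_continuous dl)).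
  move: E; rewrite scale1r scale0r addr0 subr0 mulr1 => E.
  rewrite opprD addrA [e + x]addrC E /L.
  have ce : `|c *: e| <= `|e|.
    move: c01; rewrite in_itv /= => /andP[c0 c1].
    by rewrite normrZ gtr0_norm// ler_piMl// ltW.
  have B1 : `|P1 x - P1 (x + c *: e)| <= eps / 2.
    by apply/ltW/H1; rewrite /= opprD addrA subrr add0r normrN; exact: le_lt_trans e1.
  have B2 : `|P2 x - P2 (x + c *: e)| <= eps / 2.
    by apply/ltW/H2; rewrite /= opprD addrA subrr add0r normrN; exact: le_lt_trans e2.
  have -> : e.1 * P1 (x + c *: e) + e.2 * P2 (x + c *: e) - (e.1 * P1 x + e.2 * P2 x) =
    - (e.1 * (P1 x - P1 (x + c *: e)) + e.2 * (P2 x - P2 (x + c *: e))) by ring.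
  rewrite normrN (splitr eps) mulrDl; apply: le_trans (ler_normD _ _) _.
  by rewrite !normrM; apply: lerD; rewrite mulrC ler_pM.
apply/diff_locallyP.
by rewrite (diff_unique cL o).
Qed.

End PartialDerivatives.

(** * Integration over R^3 *)

(** A countable base of neighbourhoods made of measurable sets. The neighbourhoods are a bare
    parameter [nb], which lets the topology of R be paired with the sigma-algebra of a product of
    copies of [measurableTypeR R]. *)
Definition measurable_base d (T : measurableType d) (nb : T -> set_system T) : Prop :=
  exists B : nat -> set T, (forall n, measurable (B n)) /\
    forall x A, nb x A -> exists n, B n x /\ B n `<=` A.

(** Rectangles of base sets, with pairs of indices coded as numbers; numbers that code no pair give
    the harmless empty set. *)
Lemma measurable_base_setX d1 d2 (T1 : measurableType d1) (T2 : measurableType d2)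
    (nb1 : T1 -> set_system T1) (nb2 : T2 -> set_system T2) :
  measurable_base nb1 -> measurable_base nb2 ->
  measurable_base (fun x : T1 * T2 => filter_prod (nb1 x.1) (nb2 x.2)).
Proof.
move=> [B1 [mB1 HB1]] [B2 [mB2 HB2]].
pose B n := if unpickle n is Some (i, j) then B1 i `*` B2 j else set0.
exists B; split.
  by move=> n; rewrite /B; case: unpickle => [[i j]|//]; exact: measurableX.
move=> [x y] A [[A1 A2] [/= N1 N2] sA].
have [i [Bi sBi]] := HB1 _ _ N1; have [j [Bj sBj]] := HB2 _ _ N2.
exists (pickle (i, j)); rewrite /B pickleK; split => //.
by move=> [a b] [/= ha hb]; apply: sA; split; [exact: sBi|exact: sBj].
Qed.

Section MeasurableContinuous.
Context {R : realType}.
Local Notation T := (measurableTypeR R).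

Lemma measurable_baseR : @measurable_base _ T (fun x : R => nbhs x).
Proof.
pose B n : set R := if unpickle n is Some (a, b) then
  `](ratr a : R), (ratr b : R)[%classic else set0.
exists B; split.
  by move=> n; rewrite /B; case: unpickle => [[a b]|//]; exact: measurable_itv.
move=> x A /nbhs_normP[e /= e0 sA].
have /rat_in_itvoo[a] : x - e < x by lra.
have /rat_in_itvoo[b] : x < x + e by lra.
rewrite !in_itv /= => /andP[b1 b2] /andP[a1 a2].
exists (pickle (a, b)); rewrite /B pickleK; split; first by rewrite /= in_itv /= a2 b1.
move=> y; rewrite /= in_itv /= => /andP[ya yb]; apply: sA => /=.
by rewrite ltr_distl; apply/andP; split; lra.
Qed.

(** The preimage of an open ray is the union of the base sets it contains, and there are countably
    many of these. *)
Lemma base_continuous_measurable d (T' : measurableType d)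
    (nb : T' -> set_system T') (f : T' -> R) :
  measurable_base nb -> (forall x (U : set R), nbhs (f x) U -> nb x (f @^-1` U)) ->
  measurable_fun [set: T'] (f : T' -> T).
Proof.
move=> [B [mB HB]] cf.
apply: (measurability _ (RGenOInfty.measurableE R)) => /= _ [_ [a ->]] <-.
rewrite setTI; set U := `]a, +oo[%classic.
have -> : f @^-1` U = \bigcup_n (if `[< B n `<=` f @^-1` U >] then B n else set0).
  apply/seteqP; split => [x Ux|x [n _]]; last by case: asboolP => // sB; exact: sB.
  have oU : open U by exact: interval_open.
  have [n [Bx sB]] := HB _ _ (cf x U (open_nbhs_nbhs (conj oU Ux))).
  by exists n => //; rewrite asboolT.
by apply: bigcupT_measurable => n; case: ifP => _.
Qed.

Lemma continuous_measurable2 (f : R * R -> R) : continuous f ->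
  measurable_fun setT (f : T * T -> T).
Proof.
move=> cf; apply: (base_continuous_measurable (measurable_base_setX measurable_baseR measurable_baseR)).
by move=> x U; exact: cf.
Qed.

Lemma continuous_measurable3 (f : (R * R) * R -> R) : continuous f ->
  measurable_fun setT (f : (T * T) * T -> T).
Proof.
move=> cf; apply: (base_continuous_measurable (measurable_base_setX
  (measurable_base_setX measurable_baseR measurable_baseR) measurable_baseR)).
by move=> x U; exact: cf.
Qed.

End MeasurableContinuous.

Section IteratedIntegrals.
Context {R : realType}.
Local Notation T := (measurableTypeR R).
Local Notation lam := (@lebesgue_measure R).
Local Notation lam2 := (lam \x lam)%E.

(* The norms on products are max norms, so these are supports in a cube of half-side [r]. *)
Definition cube_supported (V : normedModType R) (r : R) (f : V -> R) :=
  continuous f /\ forall p, r < `|p| -> f p = 0.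

Definition cube1 (r : R) : set R := `[- r, r]%classic.
Definition cube2 (r : R) : set (R * R) := cube1 r `*` cube1 r.
Definition cube3 (r : R) : set ((R * R) * R) := cube2 r `*` cube1 r.

Lemma cube1P r (x : R) : cube1 r x <-> `|x| <= r.
Proof. by rewrite /cube1 /= in_itv /= ler_norml. Qed.

Lemma cube2P r (x : R * R) : cube2 r x <-> `|x| <= r.
Proof.
rewrite prod_normE ge_max; split => [[/cube1P h1 /cube1P h2]|/andP[h1 h2]].
  by rewrite h1.
by split; apply/cube1P.
Qed.

Lemma cube3P r (x : (R * R) * R) : cube3 r x <-> `|x| <= r.
Proof.
rewrite prod_normE ge_max; split => [[/cube2P h1 /cube1P h2]|/andP[h1 h2]].
  by rewrite h1.
by split; [apply/cube2P|apply/cube1P].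
Qed.

Lemma lebesgue_cube1 r : 0 < r -> lam (cube1 r) = (r + r)%:E.
Proof.
move=> r0; rewrite lebesgue_measure_itv /= lte_fin ifT; first by rewrite -EFinB opprK.
by rewrite (lt_trans _ r0)// oppr_lt0.
Qed.

Lemma measurable_cube1 r : measurable (cube1 r : set T).
Proof. exact: measurable_itv. Qed.

Lemma measurable_cube2 r : measurable (cube2 r : set (T * T)).
Proof. by apply: measurableX; exact: measurable_cube1. Qed.

Lemma measurable_cube3 r : measurable (cube3 r : set ((T * T) * T)).
Proof. by apply: measurableX; [exact: measurable_cube2|exact: measurable_cube1]. Qed.

Lemma lebesgue_cube2 r : 0 < r -> lam2 (cube2 r) = ((r + r) * (r + r))%:E.
Proof.
move=> r0; have m1 := measurable_cube1 r.
rewrite (product_measure1E _ _ m1 m1); have /= -> := lebesgue_cube1 r0.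
by rewrite EFinM.
Qed.

Lemma lebesgue_cube3 r : 0 < r -> leb3 (cube3 r) = ((r + r) * (r + r) * (r + r))%:E.
Proof.
move=> r0; have m1 := measurable_cube1 r; have m2 := measurable_cube2 r.
rewrite /leb3 (product_measure1E _ _ m2 m1).
have /= E2 := lebesgue_cube2 r0; rewrite E2.
by rewrite EFinM; have /= -> := lebesgue_cube1 r0.
Qed.

Lemma bounded_supported_integrable d (S : measurableType d) (mu : {measure set S -> \bar R})
   (f : S -> R) (K : set S) (M : R) : measurable K -> (mu K < +oo)%E ->
  measurable_fun setT f -> (forall x, K x -> `|f x| <= M) -> (forall x, ~ K x -> f x = 0) ->
  mu.-integrable setT (EFin \o f).
Proof.
move=> mK Kf mf fM f0.
have -> : EFin \o f = (EFin \o f) \_ K.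
  apply/funext => x; rewrite patchE; case: ifPn => // /negP; rewrite inE => /f0 /= ->.
  by [].
apply/(integrable_mkcond _ mK); apply: measurable_bounded_integrable => //.
  exact: measurable_funS mf.
by exists M; split; [exact: num_real|move=> N MN x Kx; apply: le_trans (fM _ Kx) (ltW MN)].
Qed.

Lemma cube_integrable2 r (f : R * R -> R) : 0 < r -> cube_supported r f ->
  lam2.-integrable setT (EFin \o f).
Proof.
move=> r0 [cf f0].
have cK := compact_setX (@segment_compact R (- r) r) (@segment_compact R (- r) r).
have [M _ HM] := compact_bound cK cf.
apply: (@bounded_supported_integrable _ _ lam2 f (cube2 r) M) => //.
- exact: measurable_cube2.
- by rewrite [X in (X < _)%E]lebesgue_cube2// ltry.
- exact: continuous_measurable2.
- by move=> x Kx; apply: f0; rewrite ltNge; apply/negP => /cube2P.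
Qed.

Lemma cube_integrable3 r (f : (R * R) * R -> R) : 0 < r -> cube_supported r f ->
  leb3.-integrable setT (EFin \o f).
Proof.
move=> r0 [cf f0].
have cK := compact_setX (compact_setX (@segment_compact R (- r) r) (@segment_compact R (- r) r))
  (@segment_compact R (- r) r).
have [M _ HM] := compact_bound cK cf.
apply: (@bounded_supported_integrable _ _ leb3 f (cube3 r) M) => //.
- exact: measurable_cube3.
- by rewrite [X in (X < _)%E]lebesgue_cube3// ltry.
- exact: continuous_measurable3.
- by move=> x Kx; apply: f0; rewrite ltNge; apply/negP => /cube3P.
Qed.

End IteratedIntegrals.

(** * A piecewise polynomial cutoff of class C^2 *)

Section Cutoff.
Context {R : realType}.
Local Notation T := (measurableTypeR R).
Local Notation lam := (@lebesgue_measure R).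
Variable r : R.
Hypothesis r0 : 0 < r.

Definition cutoff_base (s : R) : R := 1 - (r ^- 2) * (s * s).
Definition cutoff_pos (s : R) : R := (cutoff_base s + `|cutoff_base s|) / 2.
(* [cutoff] is ((1 - (s/r)^2)_+)^3 and [cutoff''] its second derivative. *)
Definition cutoff (s : R) : R := cutoff_pos s * (cutoff_pos s * cutoff_pos s).
Definition cutoff'' (s : R) : R := 24 * ((r ^- 2) * (s * s)) * (r ^- 2) * cutoff_pos s
  - 6 * (r ^- 2) * (cutoff_pos s * cutoff_pos s).

Let k0 : 0 < r ^- 2. Proof. by rewrite invr_gt0 exprn_gt0. Qed.
Let kr : r ^- 2 * (r * r) = 1.
Proof. by rewrite -expr2 mulVf// expf_neq0// gt_eqF. Qed.

Lemma cutoff_base_in s : `|s| <= r -> 0 <= cutoff_base s.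
Proof.
move=> sr; rewrite /cutoff_base subr_ge0 -kr ler_pM2l//.
have : `|s| * `|s| <= r * r by rewrite ler_pM.
by rewrite -normrM ger0_norm// -expr2 sqr_ge0.
Qed.

Lemma cutoff_base_out s : r < `|s| -> cutoff_base s <= 0.
Proof.
move=> sr; rewrite /cutoff_base subr_le0 -kr ler_pM2l//.
have : r * r <= `|s| * `|s| by rewrite ler_pM// ltW.
by rewrite -normrM [X in _ <= X -> _]ger0_norm// -expr2 sqr_ge0.
Qed.

Lemma cutoff_posE s : `|s| <= r -> cutoff_pos s = cutoff_base s.
Proof. by move=> /cutoff_base_in h; rewrite /cutoff_pos ger0_norm//; field. Qed.

Lemma cutoff_pos0 s : r < `|s| -> cutoff_pos s = 0.
Proof. by move=> /cutoff_base_out h; rewrite /cutoff_pos ler0_norm// subrr mul0r. Qed.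

Lemma cutoff_pos_ge0 s : 0 <= cutoff_pos s.
Proof.
rewrite /cutoff_pos divr_ge0//; have := ler_norm (- cutoff_base s); rewrite normrN; lra.
Qed.

Lemma cutoff_pos_le1 s : cutoff_pos s <= 1.
Proof.
have [sr|sr] := leP `|s| r; last by rewrite cutoff_pos0.
rewrite cutoff_posE// /cutoff_base gerBl mulr_ge0 ?(ltW k0)// -expr2 sqr_ge0//.
Qed.

Lemma cutoff_base_continuous : continuous cutoff_base.
Proof.
move=> s; apply: cvgB; first exact: cvg_cst.
by apply: cvgM; [exact: cvg_cst|apply: cvgM; exact: cvg_id].
Qed.

Lemma cutoff_pos_continuous : continuous cutoff_pos.
Proof.
move=> s; apply: cvgM; last exact: cvg_cst.
by apply: cvgD; [exact: cutoff_base_continuous|apply: cvg_norm; exact: cutoff_base_continuous].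
Qed.

Lemma cutoff_continuous : continuous cutoff.
Proof.
move=> s; do 2 (apply: cvgM; first exact: cutoff_pos_continuous).
exact: cutoff_pos_continuous.
Qed.

Lemma cutoff''_continuous : continuous cutoff''.
Proof.
move=> s; apply: cvgB; apply: cvgM; try exact: cutoff_pos_continuous; try exact: cvg_cst.
  apply: cvgM; last exact: cvg_cst.
  apply: cvgM; first exact: cvg_cst.
  by apply: cvgM; [exact: cvg_cst|apply: cvgM; exact: cvg_id].
by apply: cvgM; exact: cutoff_pos_continuous.
Qed.

Lemma cutoff_out s : r < `|s| -> cutoff s = 0.
Proof. by move=> sr; rewrite /cutoff cutoff_pos0// mul0r. Qed.

Lemma cutoff''_out s : r < `|s| -> cutoff'' s = 0.
Proof. by move=> sr; rewrite /cutoff'' cutoff_pos0// !mulr0 subr0. Qed.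

Lemma cutoff_ge0 s : 0 <= cutoff s.
Proof. have p0 := cutoff_pos_ge0 s; exact: mulr_ge0 p0 (mulr_ge0 p0 p0). Qed.

Lemma cutoff_le1 s : cutoff s <= 1.
Proof.
have p0 := cutoff_pos_ge0 s; have p1 := cutoff_pos_le1 s.
exact: mulr_ile1 p0 (mulr_ge0 p0 p0) p1 (mulr_ile1 p0 p0 p1 p1).
Qed.

(** 30 = 24 + 6: both (s/r)^2 and [cutoff_pos s] lie in [0, 1] on the support. *)
Lemma cutoff''_le s : `|cutoff'' s| <= 30 * r ^- 2.
Proof.
have [sr|sr] := leP `|s| r; last first.
  by rewrite cutoff''_out// normr0 mulr_ge0// ltW.
have p0 := cutoff_pos_ge0 s; have p1 := cutoff_pos_le1 s.
have b0 := cutoff_base_in sr; rewrite /cutoff_base in b0.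
have t0 : 0 <= r ^- 2 * (s * s) by rewrite mulr_ge0 ?(ltW k0)// -expr2 sqr_ge0.
set t := r ^- 2 * (s * s) in b0 t0 *.
have h1 : 0 <= t * cutoff_pos s <= 1 by rewrite (mulr_ge0 t0 p0) (mulr_ile1 t0 p0 _ p1)//; lra.
have h2 : 0 <= cutoff_pos s * cutoff_pos s <= 1 by rewrite (mulr_ge0 p0 p0) (mulr_ile1 p0 p0 p1 p1).
rewrite /cutoff'' -/t.
have -> : 24 * t * r ^- 2 * cutoff_pos s - 6 * r ^- 2 * (cutoff_pos s * cutoff_pos s) =
  r ^- 2 * (24 * (t * cutoff_pos s) - 6 * (cutoff_pos s * cutoff_pos s)) by ring.
rewrite normrM gtr0_norm// mulrC ler_pM2r// ler_norml.
by move: h1 h2; generalize (t * cutoff_pos s) (cutoff_pos s * cutoff_pos s) => a b; lra.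
Qed.

(** On the inner half the base is at least 3/4; the cruder bound 1/2 gives its cube 1/8. *)
Lemma cutoff_inner s : `|s| <= r / 2 -> 8^-1 <= cutoff s.
Proof.
move=> sr; have sr' : `|s| <= r by have := r0; lra.
have h : 2^-1 <= cutoff_pos s.
  rewrite cutoff_posE// /cutoff_base.
  have : `|s| * `|s| <= (r / 2) * (r / 2) by rewrite ler_pM.
  rewrite -normrM [X in X <= _ -> _]ger0_norm -?expr2 ?sqr_ge0// => h.
  have : r ^- 2 * s ^+ 2 <= r ^- 2 * (r / 2) ^+ 2 by rewrite ler_pM2l.
  have -> : r ^- 2 * (r / 2) ^+ 2 = 4^-1.
    by rewrite exprMn mulrA mulVf ?mul1r ?expf_neq0 ?gt_eqF//; field.
  by lra.
rewrite /cutoff; have -> : 8^-1 = 2^-1 * (2^-1 * 2^-1) :> R by field.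
by rewrite ler_pM// ?mulr_ge0// ler_pM.
Qed.

Lemma cutoff_base_derive (s : R) : is_derive s 1 cutoff_base (- (2 * (r ^- 2) * s)).
Proof. by rewrite /cutoff_base; apply: is_derive_eq; rewrite -![_ *: _]/(_ * _); ring. Qed.

Lemma integral_cube1 (f : R -> R) : (forall s, r < `|s| -> f s = 0) ->
  (\int[lam]_s (f s)%:E = \int[lam]_(s in cube1 r) (f s)%:E)%E.
Proof.
move=> f0; rewrite [RHS]integral_mkcond; apply: eq_integral => s _.
rewrite patchE; case: ifPn => // /negP; rewrite inE => h.
by rewrite f0// ltNge; apply/negP => /cube1P.
Qed.

(** On [-r, r] the cutoff χ is the polynomial c^3, so both integrations by parts amount to one use
    of the fundamental theorem, for χ w' - χ' w. This vanishes at both ends because χ and χ' contain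
    the factor c^2. *)
Lemma integral_cutoff_by_parts (w w1 w2 : R -> R) :
  (forall s : R, is_derive s 1 w (w1 s)) -> (forall s : R, is_derive s 1 w1 (w2 s)) ->
  continuous w2 ->
  (\int[lam]_s (cutoff s * w2 s)%:E = \int[lam]_s (cutoff'' s * w s)%:E)%E.
Proof.
move=> dw dw1 cw2.
have cw := is_derive_continuous dw.
pose c := cutoff_base; pose k := r ^- 2.
(* [F] is χ w' - χ' w and [f] is its derivative χ w'' - χ'' w. *)
pose F (s : R) := c s * (c s * c s) * w1 s + 6 * k * (s * (c s * c s)) * w s.
pose f (s : R) := c s * (c s * c s) * w2 s
   + (6 * k * (c s * c s) - 24 * (k * (s * s)) * k * c s) * w s.
have dF (s : R) : is_derive s 1 F (f s).
  have d1 := dw s; have d2 := dw1 s; have d3 := cutoff_base_derive s.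
  rewrite /F /f /c; apply: is_derive_eq; rewrite -![_ *: _]/(_ * _) /k.
  by generalize (cutoff_base s) => b; ring.
have cf : continuous f.
  have cc := cutoff_base_continuous; move=> s; rewrite /f; apply: cvgD; apply: cvgM.
  - by do 2 (apply: cvgM; first exact: cc); exact: cc.
  - exact: cw2.
  - apply: cvgB; first by apply: cvgM; [exact: cvg_cst|apply: cvgM; exact: cc].
    apply: cvgM; last exact: cc.
    apply: cvgM; last exact: cvg_cst.
    apply: cvgM; first exact: cvg_cst.
    by apply: cvgM; [exact: cvg_cst|apply: cvgM; exact: cvg_id].
  - exact: cw.
rewrite !integral_cube1; [|by move=> s h; rewrite cutoff''_out// mul0r
  |by move=> s h; rewrite cutoff_out// mul0r].
have I0 : (\int[lam]_(s in cube1 r) (f s)%:E = 0)%E.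
  have rr : - r < r by have := r0; lra.
  rewrite (@continuous_FTC2 _ f F) //; first last.
  - by move=> x _; rewrite derive1E; case: (dF x).
  - have cF := is_derive_continuous dF; split=> [x _||]; first by case: (dF x).
    + exact/cvg_at_right_filter/cF.
    + exact/cvg_at_left_filter/cF.
  - exact: continuous_subspaceT.
  have cr : c r = 0 by rewrite /c /cutoff_base kr subrr.
  have cNr : c (- r) = 0 by rewrite /c /cutoff_base mulrNN kr subrr.
  by rewrite /F cr cNr !(mulr0, mul0r) !addr0 -EFinB subrr.
have iI (g : R -> R) : continuous g -> lam.-integrable (cube1 r) (EFin \o g).
  exact: Rintegral_continuous_integrable.
have c2 : continuous (fun s => cutoff'' s * w s).
  by move=> s; apply: cvgM; [exact: cutoff''_continuous|exact: cw].
transitivity (\int[lam]_(s in cube1 r) ((cutoff'' s * w s)%:E + (f s)%:E))%E.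
  apply: eq_integral => s; rewrite inE => /cube1P sr.
  rewrite -EFinD; congr (_%:E); rewrite /cutoff /cutoff'' cutoff_posE// /f /c /k.
  by generalize (cutoff_base s) => b; ring.
rewrite integralD //=; last 3 first.
- exact: measurable_cube1.
- exact: (iI _ c2).
- exact: (iI _ cf).
by rewrite I0 adde0.
Qed.

End Cutoff.

Section EqIntegralProd.
Context d1 d2 (T1 : measurableType d1) (T2 : measurableType d2) (R : realType).
Context (m1 : {sigma_finite_measure set T1 -> \bar R}).
Context (m2 : {sigma_finite_measure set T2 -> \bar R}).
Local Open Scope ereal_scope.

(** By Fubini an identity of one-dimensional integrals along all lines of one coordinate passes to
    the product; the two versions differ in the coordinate that is integrated first. *)
Lemma eq_integral_prod1 (F G : T1 * T2 -> \bar R) :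
  (m1 \x m2).-integrable setT F -> (m1 \x m2).-integrable setT G ->
  (forall x, \int[m2]_y F (x, y) = \int[m2]_y G (x, y)) ->
  \int[m1 \x m2]_z F z = \int[m1 \x m2]_z G z.
Proof.
move=> iF iG E; rewrite -(integral12_prod_meas1 iF) -(integral12_prod_meas1 iG).
by apply: eq_integral => x _; exact: E.
Qed.

Lemma eq_integral_prod2 (F G : T1 * T2 -> \bar R) :
  (m1 \x m2).-integrable setT F -> (m1 \x m2).-integrable setT G ->
  (forall y, \int[m1]_x F (x, y) = \int[m1]_x G (x, y)) ->
  \int[m1 \x m2]_z F z = \int[m1 \x m2]_z G z.
Proof.
move=> iF iG E; rewrite -(integral21_prod_meas1 iF) -(integral21_prod_meas1 iG).
by apply: eq_integral => y _; exact: E.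
Qed.

End EqIntegralProd.

(* The library's canonical sigma-finite structure on a product measure is only found for
   products of subprobabilities, so one is packed by hand for the plane. *)
Section PlaneMeasure.
Context {R : realType}.
Local Notation T := (measurableTypeR R).
Local Notation lam := (@lebesgue_measure R).

Lemma sigma_finite_plane : sigma_finite [set: T * T] (lam \x lam)%E.
Proof.
exists (fun n : nat => cube2 (n.+1%:R : R)).
  apply/seteqP; split => // x _; exists (Num.truncn `|x|) => //.
  by apply/cube2P; rewrite ltW// truncnS_gt.
move=> n; split; first exact: measurable_cube2.
by have /= -> := @lebesgue_cube2 R n.+1%:R (ltr0Sn _ _); rewrite ltry.
Qed.

Definition plane_measure : {sigma_finite_measure set (T * T)%type -> \bar R} :=
  HB.pack_for {sigma_finite_measure set (T * T)%type -> \bar R} (lam \x lam)%E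
    (Measure_isSigmaFinite.Build _ _ _ (lam \x lam)%E sigma_finite_plane).

End PlaneMeasure.

Lemma is_derive_eq_quotient (R : realType) (U V : normedModType R) (f : U -> R) (g : V -> R)
    x y u w df : (forall k : R, f (k *: u + x) = g (k *: w + y)) ->
  is_derive x u f df -> is_derive y w g df.
Proof.
move=> E [D1 D2]; apply: DeriveDef; first exact: (derivable_eq_quotient E D1).
by rewrite -(derive_eq_quotient E).
Qed.

Lemma continuous_pair (T U V : topologicalType) (f : T -> U) (g : T -> V) :
  continuous f -> continuous g -> continuous (fun x => (f x, g x)).
Proof.
move=> cf cg x.
apply: (@continuous2_cvg _ _ _ _ _ _ f g pair (f x) (g x)); [|exact: cf|exact: cg].
rewrite (_ : (fun z => (z.1, z.2)) = id); first exact: cvg_id.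
by apply/funext => -[].
Qed.

(** * Integration by parts against the cutoff in each coordinate *)

Section Subharmonic.
Context {R : realType}.
Local Notation T := (measurableTypeR R).
Local Notation lam := (@lebesgue_measure R).
Local Notation R3 := ((R * R) * R)%type.

Definition prod3 (a b c : R -> R) (p : R3) : R := a p.1.1 * b p.1.2 * c p.2.

Lemma prod3_cube_supported (r : R) a b c :
  cube_supported r a -> cube_supported r b -> cube_supported r c ->
  cube_supported r (prod3 a b c).
Proof.
move=> [ca a0] [cb b0] [cc c0]; split.
  move=> p; apply: cvgM; first apply: cvgM.
  - apply: (@continuous_comp _ _ _ (fun p : R3 => p.1.1) a p); last exact: ca.
    by apply: (@continuous_comp _ _ _ (fun p : R3 => p.1) fst p); exact: cvg_fst.
  - apply: (@continuous_comp _ _ _ (fun p : R3 => p.1.2) b p); last exact: cb.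
    by apply: (@continuous_comp _ _ _ (fun p : R3 => p.1) snd p); [exact: cvg_fst|exact: cvg_snd].
  - apply: (@continuous_comp _ _ _ (fun p : R3 => p.2) c p); last exact: cc.
    exact: cvg_snd.
move=> p; rewrite /prod3 !prod_normE !lt_max => /orP[/orP[/a0 ->|/b0 ->]|/c0 ->].
- by rewrite !mul0r.
- by rewrite mulr0 mul0r.
- by rewrite mulr0.
Qed.

Lemma cube_supportedM (V : normedModType R) (r : R) (f g : V -> R) :
  cube_supported r f -> continuous g -> cube_supported r (fun p => f p * g p).
Proof.
move=> [cf f0] cg; split; first by move=> p; apply: cvgM; [exact: cf|exact: cg].
by move=> p /f0 ->; rewrite mul0r.
Qed.

Lemma cutoff_supported (r : R) : 0 < r -> cube_supported r (cutoff r).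
Proof. by move=> r0; split; [exact: cutoff_continuous|move=> s; exact: cutoff_out]. Qed.

Lemma cutoff''_supported (r : R) : 0 < r -> cube_supported r (cutoff'' r).
Proof. by move=> r0; split; [exact: cutoff''_continuous|move=> s; exact: cutoff''_out]. Qed.

(** Fubini inside the plane at fixed height requires integrable slices; this supplies them. *)
Lemma cube_supported_slice1 (U V : normedModType R) (r : R) (f : U * V -> R) y :
  cube_supported r f -> cube_supported r (fun x => f (x, y)).
Proof.
move=> [cf f0]; split; last by move=> x rx; apply: f0; rewrite prod_normE lt_max rx.
have cp : continuous (fun x : U => (x, y)).
  by apply: continuous_pair => x; [exact: cvg_id|exact: cvg_cst].
by move=> x; apply: (@continuous_comp _ _ _ _ f x (cp x)); exact: cf.
Qed.

Variable r : R.
Hypothesis r0 : 0 < r.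
Variables (w : R3 -> R) (w1 w2 : 'I_3 -> R3 -> R).
Hypothesis cw : continuous w.
Hypothesis dw : forall i p, is_derive p (e3 i) w (w1 i p).
Hypothesis dw1 : forall i p, is_derive p (e3 i) (w1 i) (w2 i p).
Hypothesis cw2 : forall i, continuous (w2 i).

Let b := cutoff r.
Let b2 := cutoff'' r.
Let sb := cutoff_supported r0.
Let sb2 := cutoff''_supported r0.

(** On a line parallel to the third axis the other two cutoffs are a constant [A], which is absorbed
    into [w] before the one-dimensional identity is used. *)
Lemma parts_z :
  (\int[leb3]_p (prod3 b b b p * w2 i2 p)%:E = \int[leb3]_p (prod3 b b b2 p * w p)%:E)%E.
Proof.
pose F p := prod3 b b b p * w2 i2 p; pose G p := prod3 b b b2 p * w p.
have sF : cube_supported r F.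
  by apply: cube_supportedM => //; exact: prod3_cube_supported.
have sG : cube_supported r G.
  by apply: cube_supportedM => //; exact: prod3_cube_supported.
apply: (@eq_integral_prod1 _ _ _ _ R plane_measure lam (EFin \o F) (EFin \o G)
  (cube_integrable3 r0 sF) (cube_integrable3 r0 sG)).
move=> [x1 x2]; pose A := b x1 * b x2.
have d1 (s : R) : is_derive s 1 (fun s => A * w ((x1, x2), s)) (A * w1 i2 ((x1, x2), s)).
  have dd : is_derive s 1 (fun s => w ((x1, x2), s)) (w1 i2 ((x1, x2), s)).
    apply: is_derive_eq_quotient (dw i2 ((x1, x2), s)) => k.
    by congr (w ((_, _), _)); rewrite /= scaler0 add0r.
  by apply: is_derive_eq; rewrite -[_ *: _]/(_ * _); ring.
have d2 (s : R) : is_derive s 1 (fun s => A * w1 i2 ((x1, x2), s)) (A * w2 i2 ((x1, x2), s)).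
  have dd : is_derive s 1 (fun s => w1 i2 ((x1, x2), s)) (w2 i2 ((x1, x2), s)).
    apply: is_derive_eq_quotient (dw1 i2 ((x1, x2), s)) => k.
    by congr (w1 _ ((_, _), _)); rewrite /= scaler0 add0r.
  by apply: is_derive_eq; rewrite -[_ *: _]/(_ * _); ring.
have c2 : continuous (fun s => A * w2 i2 ((x1, x2), s)).
  have cp : continuous (fun s : R => ((x1, x2), s)).
    by apply: continuous_pair => s; [exact: cvg_cst|exact: cvg_id].
  move=> s; apply: cvgM; first exact: cvg_cst.
  exact: (@continuous_comp _ _ _ _ (w2 i2) s (cp s) (@cw2 i2 _)).
transitivity (\int[lam]_s (b s * (A * w2 i2 ((x1, x2), s)))%:E)%E.
  by apply: eq_integral => s _; congr (_%:E); rewrite /F /G /prod3 /= -/A; ring.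
rewrite (integral_cutoff_by_parts r0 d1 d2 c2).
by apply: eq_integral => s _; congr (_%:E); rewrite /F /G /prod3 /= -/A -/b2; ring.
Qed.

Lemma parts_y :
  (\int[leb3]_p (prod3 b b b p * w2 i1 p)%:E = \int[leb3]_p (prod3 b b2 b p * w p)%:E)%E.
Proof.
pose F p := prod3 b b b p * w2 i1 p; pose G p := prod3 b b2 b p * w p.
have sF : cube_supported r F.
  by apply: cube_supportedM => //; exact: prod3_cube_supported.
have sG : cube_supported r G.
  by apply: cube_supportedM => //; exact: prod3_cube_supported.
have iFy y := cube_integrable2 r0 (cube_supported_slice1 y sF).
have iGy y := cube_integrable2 r0 (cube_supported_slice1 y sG).
(* The second coordinate is inner to both products: the height is frozen here, and the first
   coordinate next. *)
apply: (@eq_integral_prod2 _ _ _ _ R plane_measure lam (EFin \o F) (EFin \o G)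
  (cube_integrable3 r0 sF) (cube_integrable3 r0 sG)) => y.
apply: (@eq_integral_prod1 _ _ _ _ R lam lam _ _ (iFy y) (iGy y)) => x1; pose A := b x1 * b y.
have d1 (s : R) : is_derive s 1 (fun s => A * w ((x1, s), y)) (A * w1 i1 ((x1, s), y)).
  have dd : is_derive s 1 (fun s => w ((x1, s), y)) (w1 i1 ((x1, s), y)).
    apply: is_derive_eq_quotient (dw i1 ((x1, s), y)) => k.
    by congr (w ((_, _), _)); rewrite /= scaler0 add0r.
  by apply: is_derive_eq; rewrite -[_ *: _]/(_ * _); ring.
have d2 (s : R) : is_derive s 1 (fun s => A * w1 i1 ((x1, s), y)) (A * w2 i1 ((x1, s), y)).
  have dd : is_derive s 1 (fun s => w1 i1 ((x1, s), y)) (w2 i1 ((x1, s), y)).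
    apply: is_derive_eq_quotient (dw1 i1 ((x1, s), y)) => k.
    by congr (w1 _ ((_, _), _)); rewrite /= scaler0 add0r.
  by apply: is_derive_eq; rewrite -[_ *: _]/(_ * _); ring.
have c2 : continuous (fun s => A * w2 i1 ((x1, s), y)).
  have cp : continuous (fun s : R => ((x1, s), y)).
    apply: continuous_pair => s; last exact: cvg_cst.
    by apply: continuous_pair => {}s; [exact: cvg_cst|exact: cvg_id].
  move=> s; apply: cvgM; first exact: cvg_cst.
  exact: (@continuous_comp _ _ _ _ (w2 i1) s (cp s) (@cw2 i1 _)).
transitivity (\int[lam]_s (b s * (A * w2 i1 ((x1, s), y)))%:E)%E.
  by apply: eq_integral => s _; congr (_%:E); rewrite /F /G /prod3 /= /A; ring.
rewrite (integral_cutoff_by_parts r0 d1 d2 c2).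
by apply: eq_integral => s _; congr (_%:E); rewrite /F /G /prod3 /= /A -/b2; ring.
Qed.

Lemma parts_x :
  (\int[leb3]_p (prod3 b b b p * w2 i0 p)%:E = \int[leb3]_p (prod3 b2 b b p * w p)%:E)%E.
Proof.
pose F p := prod3 b b b p * w2 i0 p; pose G p := prod3 b2 b b p * w p.
have sF : cube_supported r F.
  by apply: cube_supportedM => //; exact: prod3_cube_supported.
have sG : cube_supported r G.
  by apply: cube_supportedM => //; exact: prod3_cube_supported.
have iFy y := cube_integrable2 r0 (cube_supported_slice1 y sF).
have iGy y := cube_integrable2 r0 (cube_supported_slice1 y sG).
apply: (@eq_integral_prod2 _ _ _ _ R plane_measure lam (EFin \o F) (EFin \o G)
  (cube_integrable3 r0 sF) (cube_integrable3 r0 sG)) => y.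
apply: (@eq_integral_prod2 _ _ _ _ R lam lam _ _ (iFy y) (iGy y)) => x2; pose A := b x2 * b y.
have d1 (s : R) : is_derive s 1 (fun s => A * w ((s, x2), y)) (A * w1 i0 ((s, x2), y)).
  have dd : is_derive s 1 (fun s => w ((s, x2), y)) (w1 i0 ((s, x2), y)).
    apply: is_derive_eq_quotient (dw i0 ((s, x2), y)) => k.
    by congr (w ((_, _), _)); rewrite /= scaler0 add0r.
  by apply: is_derive_eq; rewrite -[_ *: _]/(_ * _); ring.
have d2 (s : R) : is_derive s 1 (fun s => A * w1 i0 ((s, x2), y)) (A * w2 i0 ((s, x2), y)).
  have dd : is_derive s 1 (fun s => w1 i0 ((s, x2), y)) (w2 i0 ((s, x2), y)).
    apply: is_derive_eq_quotient (dw1 i0 ((s, x2), y)) => k.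
    by congr (w1 _ ((_, _), _)); rewrite /= scaler0 add0r.
  by apply: is_derive_eq; rewrite -[_ *: _]/(_ * _); ring.
have c2 : continuous (fun s => A * w2 i0 ((s, x2), y)).
  have cp : continuous (fun s : R => ((s, x2), y)).
    apply: continuous_pair => s; last exact: cvg_cst.
    by apply: continuous_pair => {}s; [exact: cvg_id|exact: cvg_cst].
  move=> s; apply: cvgM; first exact: cvg_cst.
  exact: (@continuous_comp _ _ _ _ (w2 i0) s (cp s) (@cw2 i0 _)).
transitivity (\int[lam]_s (b s * (A * w2 i0 ((s, x2), y)))%:E)%E.
  by apply: eq_integral => s _; congr (_%:E); rewrite /F /G /prod3 /= /A; ring.
rewrite (integral_cutoff_by_parts r0 d1 d2 c2).
by apply: eq_integral => s _; congr (_%:E); rewrite /F /G /prod3 /= /A -/b2; ring.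
Qed.

End Subharmonic.

(** * Integrable subharmonic functions *)

Section L1Subharmonic.
Context {R : realType}.
Local Notation R3 := ((R * R) * R)%type.
Variables (w : R3 -> R) (w1 w2 : 'I_3 -> R3 -> R).
Hypothesis cw : continuous w.
Hypothesis dw : forall i p, is_derive p (e3 i) w (w1 i p).
Hypothesis dw1 : forall i p, is_derive p (e3 i) (w1 i) (w2 i p).
Hypothesis cw2 : forall i, continuous (w2 i).
Hypothesis w0 : forall p, 0 <= w p.
Hypothesis wL1 : (\int[leb3]_p (w p)%:E < +oo)%E.

Let lapw p := w2 i0 p + w2 i1 p + w2 i2 p.
Hypothesis lapw0 : forall p, 0 <= lapw p.

Let clapw : continuous lapw.
Proof. by move=> p; do 2 (apply: cvgD; last exact: cw2); exact: cw2. Qed.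

Let w_integrable : leb3.-integrable setT (EFin \o w).
Proof.
apply/integrableP; split; first by apply/measurable_EFinP; exact: continuous_measurable3.
by under eq_integral do rewrite /= ger0_norm//.
Qed.

(** Moving the three second derivatives onto the cutoff leaves three terms, each at most 30 r^-2
    times [w]; hence 90. Since [w] is nonnegative the bound holds pointwise. *)
Lemma cutoff_lap_le (r : R) : 0 < r ->
  (\int[leb3]_p (prod3 (cutoff r) (cutoff r) (cutoff r) p * lapw p)%:E <=
   (90 * r ^- 2)%:E * \int[leb3]_p (w p)%:E)%E.
Proof.
move=> r0; set c := cutoff r; set c2 := cutoff'' r.
have sc := cutoff_supported r0; have sc2 := cutoff''_supported r0.
have s1 i : cube_supported r (fun p => prod3 c c c p * w2 i p).
  by apply: cube_supportedM => //; exact: prod3_cube_supported.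
have iI f : cube_supported r f -> leb3.-integrable setT (fun p => (f p)%:E).
  exact: cube_integrable3.
have t1 : cube_supported r (fun p => prod3 c2 c c p * w p).
  by apply: cube_supportedM => //; exact: prod3_cube_supported.
have t2 : cube_supported r (fun p => prod3 c c2 c p * w p).
  by apply: cube_supportedM => //; exact: prod3_cube_supported.
have t3 : cube_supported r (fun p => prod3 c c c2 p * w p).
  by apply: cube_supportedM => //; exact: prod3_cube_supported.
have -> : (\int[leb3]_p (prod3 c c c p * lapw p)%:E =
   \int[leb3]_p ((prod3 c2 c c p * w p)%:E +
     ((prod3 c c2 c p * w p)%:E + (prod3 c c c2 p * w p)%:E)))%E.
  transitivity (\int[leb3]_p ((prod3 c c c p * w2 i0 p)%:E +
     ((prod3 c c c p * w2 i1 p)%:E + (prod3 c c c p * w2 i2 p)%:E)))%E.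
    by apply: eq_integral => p _; rewrite -!EFinD; congr (_%:E); rewrite /lapw; ring.
  rewrite integralD//; [|exact: iI|by apply: integrableD => //; exact: iI].
  rewrite integralD//; [|exact: iI|exact: iI].
  rewrite [RHS]integralD//; [|exact: iI|by apply: integrableD => //; exact: iI].
  rewrite [in RHS]integralD//; [|exact: iI|exact: iI].
  congr (_ + (_ + _))%E.
  - exact: (parts_x r0 cw dw dw1 cw2).
  - exact: (parts_y r0 cw dw dw1 cw2).
  - exact: (parts_z r0 cw dw dw1 cw2).
rewrite -integralZl//; apply: le_integral => //.
- by apply: integrableD => //; [exact: iI|apply: integrableD => //; exact: iI].
- exact: integrableZl.
move=> p _; rewrite -!EFinD -EFinM lee_fin -!mulrDl ler_wpM2r//.
have B (x y z : R) : `|x| <= 1 -> `|y| <= 1 -> `|z| <= 30 * r ^- 2 -> x * y * z <= 30 * r ^- 2.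
  move=> hx hy hz; apply: le_trans (ler_norm _) _; rewrite !normrM.
  by apply: le_trans hz; rewrite ler_piMl// mulr_ile1.
have c1 s : `|c s| <= 1 by rewrite ger0_norm ?cutoff_le1// cutoff_ge0.
have c2b s : `|c2 s| <= 30 * r ^- 2 by exact: cutoff''_le.
have -> : 90 * r ^- 2 = 30 * r ^- 2 + (30 * r ^- 2 + 30 * r ^- 2) by ring.
rewrite /prod3; apply: lerD; first by rewrite -mulrA mulrC; exact: B.
by apply: lerD; [rewrite mulrAC; exact: B|exact: B].
Qed.

Lemma measurable_ball3 (p : R3) (d : R) : measurable
  (((ball p.1.1 d `*` ball p.1.2 d) `*` ball p.2 d) 
    : set ((measurableTypeR R * measurableTypeR R) * measurableTypeR R)).
Proof. by apply: measurableX; [apply: measurableX|]; exact: measurable_ball. Qed.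

Lemma lebesgue_ball3 (p : R3) (d : R) : 0 < d ->
  leb3 ((ball p.1.1 d `*` ball p.1.2 d) `*` ball p.2 d) = ((2 * d) * (2 * d) * (2 * d))%:E.
Proof.
move=> d0; have mb (x : R) : measurable (ball x d : set (measurableTypeR R)) by exact: measurable_ball.
have mb2 := measurableX (mb p.1.1) (mb p.1.2).
rewrite /leb3 (product_measure1E _ _ mb2 (mb p.2)).
have E2 := product_measure1E (@lebesgue_measure R) (@lebesgue_measure R) (mb p.1.1) (mb p.1.2).
have L (x : R) : @lebesgue_measure R (ball x d) = (2 * d)%:E.
  by rewrite lebesgue_measure_ball ?ltW// mulr_natl.
rewrite (EFinM (2 * d * (2 * d))) (EFinM (2 * d)); congr (_ * _)%E; last exact: L.
by rewrite [LHS]E2; congr (_ * _)%E; exact: L.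
Qed.

(** If the Laplacian were positive at [p], it would exceed half its value on a small cube around
    [p]. The tested integral would then stay above a constant independent of [r], against its decay
    as [r] grows. *)
Lemma L1_subharmonic_harmonic p : lapw p = 0.
Proof.
apply/eqP; rewrite eq_le lapw0 andbT leNgt; apply/negP => c0.
have h0 : 0 < lapw p / 2 by rewrite divr_gt0.
have /cvgrPdist_lt/(_ _ h0)/nbhs_normP[d /= d0 Hd] := @clapw p.
pose B : set R3 := (ball p.1.1 d `*` ball p.1.2 d) `*` ball p.2 d.
have BE q : B q -> `|p - q| < d.
  move=> [[h1 h2] h3]; rewrite prod_normE gt_max prod_normE gt_max.
  by apply/andP; split; [apply/andP; split|].
pose I := fine (\int[leb3]_p (w p)%:E).
have IE : (\int[leb3]_p (w p)%:E = I%:E)%E.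
  by rewrite fineK// ge0_fin_numE// integral_ge0// => q _; rewrite lee_fin.
have I0 : 0 <= I by rewrite fine_ge0// integral_ge0// => q _; rewrite lee_fin.
(* Lower bound of the integrand on [B]: 1/8 for each cutoff factor, half the value at [p] for the
   Laplacian. *)
pose a := 8^-1 * 8^-1 * 8^-1 * (lapw p / 2).
have a0 : 0 < a by rewrite !mulr_gt0.
pose b := a * ((2 * d) * (2 * d) * (2 * d)).
have b0 : 0 < b by rewrite !mulr_gt0.
(* The first summand makes 90 I / r smaller than [b], the second puts [B] into the cube of half-side
   r/2, and the 1 gives r^-2 <= r^-1. *)
pose r := 90 * I / b + 2 * (`|p| + d) + 1.
have q0 : 0 <= 90 * I / b by apply: divr_ge0; [exact: mulr_ge0|exact: ltW].
have p0 : 0 <= `|p| by [].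
have r0 : 0 < r by rewrite /r; lra.
have r1 : 1 <= r by rewrite /r; lra.
have := cutoff_lap_le r0; rewrite IE -EFinM leNgt => /negP; apply.
apply: (@lt_le_trans _ _ b%:E).
  rewrite lte_fin; apply: (@le_lt_trans _ _ (90 * I / r)).
    rewrite mulrAC; apply: ler_wpM2l; first exact: mulr_ge0.
    rewrite lef_pV2 ?posrE ?exprn_gt0//.
    by rewrite expr2 ler_peMl// ltW.
  rewrite ltr_pdivrMr// -ltr_pdivrMl// mulrC /r; lra.
have sc := cutoff_supported r0.
have [cF _] := cube_supportedM (prod3_cube_supported sc sc sc) clapw.
have -> : b%:E = (\int[leb3]_(q in B) (a%:E))%E.
  rewrite integral_cst; last exact: measurable_ball3.
  by rewrite EFinM; congr (_ * _)%E; exact/esym/lebesgue_ball3.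
rewrite integral_mkcond; apply: ge0_le_integral => //.
- by move=> q _; rewrite patchE; case: ifP => // _; rewrite lee_fin ltW.
- apply/(measurable_restrictT _ _).1 => //; exact: measurable_ball3.
- by apply/measurable_EFinP; exact: continuous_measurable3.
move=> q _; rewrite patchE; case: ifPn => [|_]; last first.
  rewrite lee_fin; apply: mulr_ge0; last exact: lapw0.
  by apply: mulr_ge0; [apply: mulr_ge0|]; exact: cutoff_ge0.
rewrite inE => /BE pq; rewrite lee_fin.
have qr : `|q| <= r / 2.
  have : `|q| <= `|p| + `|p - q|.
    by rewrite -[X in `|X| <= _](subKr p q); exact: ler_normB.
  by rewrite /r; lra.
have q1 : `|q.1.1| <= r / 2 /\ `|q.1.2| <= r / 2 /\ `|q.2| <= r / 2.
  by move: qr; rewrite prod_normE ge_max prod_normE ge_max => /andP[/andP[]].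
have [k1 [k2 k3]] := q1.
have e8 : 0 <= 8^-1 :> R by [].
rewrite /a /prod3; apply: ler_pM; [exact: (mulr_ge0 (mulr_ge0 e8 e8) e8)|exact: ltW| |].
  apply: ler_pM; [exact: (mulr_ge0 e8 e8)|exact: e8| |exact: cutoff_inner].
  by apply: ler_pM => //; exact: cutoff_inner.
by have := Hd _ pq; rewrite /= ltr_norml; lra.
Qed.

End L1Subharmonic.

(** * Uniqueness of the harmonic extension *)

Section ZeroExtension.
Context {R : realType} {V : normedModType R}.
Variable zeta : V -> R.
Hypothesis czeta : continuous zeta.

Definition zero_ext (F : V -> R) (q : V) : R := if 0 <= zeta q then F q else 0.

Lemma zero_ext_le (F : V -> R) q : `|zero_ext F q| <= `|F q|.
Proof. by rewrite /zero_ext; case: ifP => // _; rewrite normr0. Qed.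

(** Off the zero set the sign of [zeta] is locally constant, so an extension by zero coincides there
    locally with [F] or with 0. *)
Lemma zero_ext_near q : zeta q != 0 -> exists2 d : R, 0 < d & forall y, `|q - y| < d ->
  (0 <= zeta y) = (0 <= zeta q).
Proof.
move=> z0; have n0 : 0 < `|zeta q| by rewrite normr_gt0.
have /cvgrPdist_lt/(_ _ n0)/nbhs_normP[d /= d0 Hd] := @czeta q.
exists d => // y /Hd /=; have [h|h] := leP 0 (zeta q).
  by rewrite (ger0_norm h) => H; have := le_lt_trans (ler_norm _) H; rewrite ltrBlDr ltrDl => /ltW.
rewrite (ltr0_norm h) distrC => H; have := le_lt_trans (ler_norm _) H.
by rewrite ltrBlDr addNr ltNge => /negbTE.
Qed.

Lemma zero_ext_near_eq (F : V -> R) q : zeta q != 0 ->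
  \forall y \near q, (if 0 <= zeta q then F y else 0) = zero_ext F y.
Proof.
move=> /zero_ext_near[d d0 Hd]; apply/nbhs_normP; exists d => // y /= /Hd.
by rewrite /zero_ext => ->.
Qed.

Lemma zero_ext_continuous (F : V -> R) : continuous F ->
  (forall q, zeta q = 0 -> F q = 0) -> continuous (zero_ext F).
Proof.
move=> cF F0 q; apply/cvgrPdist_lt => e e0.
have /cvgrPdist_lt/(_ _ e0)/nbhs_normP[d /= d0 Hd] := @cF q.
apply/nbhs_normP; have [z0|z0] := eqVneq (zeta q) 0.
  exists d => // y /= /Hd; rewrite /zero_ext z0 lexx F0// !sub0r !normrN.
  exact/le_lt_trans/zero_ext_le.
have [d' d'0 Hd'] := zero_ext_near z0.
exists (Num.min d d'); first by rewrite /= lt_min d0.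
move=> y; rewrite /= lt_min => /andP[/Hd h /Hd' h'].
by rewrite /zero_ext h'; case: ifP => // _; rewrite subrr normr0.
Qed.

(** At a zero of [zeta] both [F] and its derivative vanish, so the quotient of the extension is
    dominated by that of [F], which tends to 0. The shape of the zero set never enters. *)
Lemma zero_ext_derive (F dF : V -> R) e : (forall q, is_derive q e F (dF q)) ->
  (forall q, zeta q = 0 -> F q = 0) -> (forall q, zeta q = 0 -> dF q = 0) ->
  forall q, is_derive q e (zero_ext F) (zero_ext dF q).
Proof.
move=> dFE F0 dF0 q; have [z0|z0] := eqVneq (zeta q) 0; last first.
  apply: (near_eq_is_derive (zero_ext_near_eq F z0)).
  rewrite /zero_ext; case: ifP => _; first exact: dFE.
  exact: is_derive_cst.
have E0 : zero_ext F q = 0 by rewrite /zero_ext z0 lexx F0.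
have -> : zero_ext dF q = 0 by rewrite /zero_ext z0 lexx dF0.
have [D1 D2] := dFE q; rewrite (dF0 _ z0) in D2.
have L : (fun k : R => k^-1 *: (zero_ext F (k *: e + q) - zero_ext F q)) @ 0^' --> (0 : R).
  have LF : (fun k : R => k^-1 *: (F (k *: e + q) - F q)) @ 0^' --> (0 : R).
    have D3 : (fun k : R => k^-1 *: (F (k *: e + q) - F q)) @ 0^' --> derive F q e by exact: D1.
    by rewrite D2 in D3.
  apply: norm_cvg0; apply: (@squeeze_cvgr _ _ _ _ (cst 0)
    (fun k : R => `|k^-1 *: (F (k *: e + q) - F q)|)).
  - near=> k; rewrite normr_ge0 /= !normrZ; apply: ler_wpM2l => //.
    by rewrite E0 (F0 _ z0) !subr0; exact: zero_ext_le.
  - exact: cvg_cst.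
  - exact/norm_cvg0P.
by apply: DeriveDef; [apply/cvg_ex; exists 0|exact/cvg_lim].
Unshelve. all: by end_near. Qed.

End ZeroExtension.

Lemma sum_ord3 (R : realType) (f : 'I_3 -> R) : \sum_(i < 3) f i = f i0 + f i1 + f i2.
Proof.
rewrite !big_ord_recl big_ord0 addr0 addrA.
by congr (f _ + f _ + f _); exact: val_inj.
Qed.

Section Uniqueness.
Context {R : realType}.
Local Notation R3 := ((R * R) * R)%type.
Local Notation T := (measurableTypeR R).
Variable h : R * R -> R.
Hypothesis ch : continuous h.

Let zeta (q : R3) : R := h q.1 - q.2.

Let czeta : continuous zeta.
Proof.
move=> q; apply: cvgB; last exact: cvg_snd.
by apply: (@continuous_comp _ _ _ fst h q); [exact: cvg_fst|exact: ch].
Qed.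

Let DomE q : Dom h q <-> 0 <= zeta q.
Proof. by rewrite /Dom /zeta /= subr_ge0. Qed.

Lemma measurable_Dom : measurable (Dom h : set ((T * T) * T)).
Proof.
have mz := continuous_measurable3 czeta.
have -> : Dom h = [set: (T * T) * T] `&` (zeta @^-1` `[0, +oo[%classic).
  by apply/seteqP; split=> [q /DomE|q [_]]; rewrite /= in_itv /= andbT // => /DomE.
by apply: mz => //; exact: measurable_itv.
Qed.

(* [u ^ 6] vanishes to sixth order on the boundary, so its extension by zero is C^2 and the
   boundary never enters the integration by parts. *)
Lemma harmonic_L6_zero (u : R3 -> R) : smooth u -> (forall q, Dom h q -> lap u q = 0) ->
  (forall x, u (x, h x) = 0) -> L6 (Dom h) u -> forall q, Dom h q -> u q = 0.
Proof.
move=> su lu u0 uL6.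
have bz q : zeta q = 0 -> u q = 0.
  by case: q => x y /eqP; rewrite /zeta /= subr_eq0 => /eqP <-; exact: u0.
pose D i q := derive u q (e3 i); pose DD i q := derive (D i) q (e3 i).
have cu := smooth_continuous su.
have sD i : smooth (D i) by exact: smooth_derive.
have cD i := smooth_continuous (sD i).
have cDD i : continuous (DD i) by exact/smooth_continuous/smooth_derive.
have du i q : is_derive q (e3 i) u (D i q).
  by apply: DeriveDef => //; apply: diff_derivable; exact: smooth_differentiable.
have dD i q : is_derive q (e3 i) (D i) (DD i q).
  by apply: DeriveDef => //; apply: diff_derivable; exact: smooth_differentiable.
pose p4 q := u q * u q * (u q * u q); pose p5 q := u q * p4 q.
have cp4 : continuous p4 by move=> q; apply: cvgM; apply: cvgM; exact: cu.
have cp5 : continuous p5 by move=> q; apply: cvgM; [exact: cu|exact: cp4].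
pose F0 q := u q * p5 q.
pose F1 i q := 6 * (p5 q * D i q).
pose F2 i q := 30 * (p4 q * (D i q * D i q)) + 6 * (p5 q * DD i q).
have dF0 i q : is_derive q (e3 i) F0 (F1 i q).
  have d1 := du i q; rewrite /F0 /F1 /p5 /p4; apply: is_derive_eq.
  by rewrite -![_ *: _]/(_ * _); ring.
have dF1 i q : is_derive q (e3 i) (F1 i) (F2 i q).
  have d1 := du i q; have d2 := dD i q; rewrite /F1 /F2 /p5 /p4; apply: is_derive_eq.
  by rewrite -![_ *: _]/(_ * _); ring.
have cF0 : continuous F0 by move=> q; apply: cvgM; [exact: cu|exact: cp5].
have cF2 i : continuous (F2 i).
  move=> q; apply: cvgD; (apply: cvgM; first exact: cvg_cst).
    by apply: cvgM; [exact: cp4|apply: cvgM; exact: cD].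
  by apply: cvgM; [exact: cp5|exact: cDD].
have p40 q : zeta q = 0 -> p4 q = 0 by move=> /bz; rewrite /p4 => ->; rewrite !mul0r.
have p50 q : zeta q = 0 -> p5 q = 0 by move=> /bz; rewrite /p5 => ->; rewrite mul0r.
have F00 q : zeta q = 0 -> F0 q = 0 by move=> /bz; rewrite /F0 => ->; rewrite mul0r.
have F10 i q : zeta q = 0 -> F1 i q = 0 by move=> /p50; rewrite /F1 => ->; rewrite mul0r mulr0.
have F20 i q : zeta q = 0 -> F2 i q = 0.
  by move=> z0; rewrite /F2 p40// p50// !mul0r !mulr0 addr0.
have p4_ge0 q : 0 <= p4 q by rewrite /p4 -expr2 sqr_ge0.
pose w := zero_ext zeta F0; pose w1 i := zero_ext zeta (F1 i); pose w2 i := zero_ext zeta (F2 i).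
have cw : continuous w by exact: (zero_ext_continuous czeta cF0 F00).
have dw i q : is_derive q (e3 i) w (w1 i q).
  exact: (zero_ext_derive czeta (dF0 i) F00 (F10 i)).
have dw1 i q : is_derive q (e3 i) (w1 i) (w2 i q).
  exact: (zero_ext_derive czeta (dF1 i) (F10 i) (F20 i)).
have cw2 i : continuous (w2 i) by exact: (zero_ext_continuous czeta (@cF2 i) (F20 i)).
have w0 q : 0 <= w q.
  rewrite /w /zero_ext; case: ifP => // _; rewrite /F0 /p5 mulrA mulr_ge0//.
  by rewrite -expr2 sqr_ge0.
have wL1 : (\int[leb3]_q (w q)%:E < +oo)%E.
  apply: le_lt_trans uL6; rewrite /L6 [leRHS]integral_mkcond.
  rewrite (_ : (fun q => (w q)%:E) = (fun q => (u q ^+ 6)%:E) \_ (Dom h)) //.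
  apply/funext => q; rewrite patchE; case: ifPn.
    rewrite inE => /DomE zq; rewrite /w /zero_ext zq; congr (_%:E).
    by rewrite /F0 /p5 /p4; ring.
  move=> /negP qD; rewrite /w /zero_ext ifF //; apply/negP => /DomE qD'.
  by apply: qD; rewrite inE.
(* Read P = u^4, Q = u^5, with a, b, c the first and A, B, C the pure second derivatives:
   harmonicity removes the terms in Q. *)
have alg (P Q a b c A B C : R) : A + B + C = 0 ->
    30 * (P * (a * a)) + 6 * (Q * A) + (30 * (P * (b * b)) + 6 * (Q * B)) +
    (30 * (P * (c * c)) + 6 * (Q * C)) = 30 * (P * (a * a + b * b + c * c)).
  by move=> /eqP; rewrite addrC addr_eq0 => /eqP ->; ring.
have lapE q : Dom h q -> w2 i0 q + w2 i1 q + w2 i2 q =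
   30 * (p4 q * (D i0 q * D i0 q + D i1 q * D i1 q + D i2 q * D i2 q)).
  move=> qD; have L : DD i0 q + DD i1 q + DD i2 q = 0.
    by rewrite -(lu q qD); exact/esym/sum_ord3.
  move/DomE: qD => zq; rewrite /w2 /zero_ext zq /F2.
  exact: alg.
have lap_ge0 q : 0 <= w2 i0 q + w2 i1 q + w2 i2 q.
  have [zq|zq] := boolP (0 <= zeta q); last by rewrite /w2 /zero_ext (negbTE zq) !addr0.
  rewrite lapE; last exact/DomE.
  by rewrite mulr_ge0// mulr_ge0// !addr_ge0// -expr2 sqr_ge0.
have alg2 (U a b c : R) : 30 * (U * U * (U * U) * (a * a + b * b + c * c)) = 0 -> U * c = 0.
  move=> /eqP; rewrite mulf_eq0 pnatr_eq0 /= mulf_eq0 !mulf_eq0 !orbb.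
  case/orP => [/eqP ->|]; first by rewrite mul0r.
  rewrite -!expr2 paddr_eq0 ?addr_ge0 ?sqr_ge0// sqrf_eq0 => /andP[_ /eqP ->].
  by rewrite mulr0.
have H q : Dom h q -> u q * D i2 q = 0.
  move=> qD; have := L1_subharmonic_harmonic cw dw dw1 cw2 w0 wL1 lap_ge0 q.
  by rewrite lapE //; exact: alg2.
move=> [x y]; rewrite /Dom /= le_eqVlt => /orP[/eqP ->|yh]; first exact: u0.
(* The vertical derivative is enough: u^2 is constant on the vertical segment up to the surface,
   which stays in the domain and ends where [u] is 0. *)
have dl (s : R) : is_derive s 1 (fun s => u (x, s) * u (x, s)) (2 * (u (x, s) * D i2 (x, s))).
  have d1 : is_derive s 1 (fun s => u (x, s)) (D i2 (x, s)).
    apply: is_derive_eq_quotient (du i2 (x, s)) => k.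
    by congr (u (_, _)); rewrite /= [X in X + _](_ : _ = 0) ?add0r//; congr (_, _); rewrite /= scaler0.
  by apply: is_derive_eq; rewrite -![_ *: _]/(_ * _); ring.
have [c] := MVT yh (fun s _ => dl s) (continuous_subspaceT (is_derive_continuous dl)).
rewrite in_itv /= => /andP[_ ch']; rewrite H; last by rewrite /Dom /= ltW.
by rewrite mulr0 mul0r u0 mul0r sub0r => /eqP; rewrite oppr_eq0 mulf_eq0 orbb => /eqP.
Qed.

End Uniqueness.

(** * Independence of the Dirichlet-to-Neumann operator from the chosen extension *)

Section DirichletNeumann.
Context {R : realType}.
Local Notation R3 := ((R * R) * R)%type.
Local Notation T := (measurableTypeR R).
Variable h : R * R -> R.
Hypothesis ch : continuous h.

(** The constant comes from (f - g)^2 <= 2 (f^2 + g^2) followed by (A + B)^3 <= 4 (A^3 + B^3): 2^3 *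
    4 = 32. *)
Lemma L6B (f g : R3 -> R) : continuous f -> continuous g ->
  L6 (Dom h) f -> L6 (Dom h) g -> L6 (Dom h) (fun q => f q - g q).
Proof.
move=> cf cg f6 g6; have mD := measurable_Dom ch.
have m6 (k : R3 -> R) : continuous k ->
    measurable_fun (Dom h : set ((T * T) * T)) (fun q => (k q ^+ 6)%:E).
  move=> ck; apply/measurable_EFinP; apply: measurable_funS (continuous_measurable3 _) => //.
  by move=> q; apply: (@continuous_comp _ _ _ k (fun x => x ^+ 6) q (@ck q)); exact: exprn_continuous.
have p6 (x : R) : 0 <= x ^+ 6 by rewrite -[6%N]/(3 * 2)%N exprM sqr_ge0.
rewrite /L6.
apply: (@le_lt_trans _ _ (\int[leb3]_(q in Dom h) (32%:E * ((f q ^+ 6)%:E + (g q ^+ 6)%:E)))%E).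
  apply: ge0_le_integral => //.
  - by move=> q _; rewrite lee_fin.
  - by apply: (m6 (fun q => f q - g q)) => q; apply: cvgB; [exact: cf|exact: cg].
  - by apply: emeasurable_funM => //; apply: emeasurable_funD; exact: m6.
  move=> q _; rewrite -EFinD -EFinM lee_fin.
  have key (A B : R) : 0 <= A -> 0 <= B -> (A + B) ^+ 3 <= 4 * (A ^+ 3 + B ^+ 3).
    move=> A0 B0; rewrite -subr_ge0.
    have -> : 4 * (A ^+ 3 + B ^+ 3) - (A + B) ^+ 3 = 3 * ((A + B) * (A - B) ^+ 2) by ring.
    by rewrite mulr_ge0// mulr_ge0// ?addr_ge0// sqr_ge0.
  have -> (x : R) : x ^+ 6 = (x ^+ 2) ^+ 3 by rewrite -exprM.
  have -> (x : R) : x ^+ 6 = (x ^+ 2) ^+ 3 by rewrite -exprM.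
  apply: (@le_trans _ _ ((2 * (f q ^+ 2 + g q ^+ 2)) ^+ 3)).
    apply: lerXn2r; rewrite ?nnegrE ?sqr_ge0// ?mulr_ge0 ?addr_ge0 ?sqr_ge0//.
    rewrite -subr_ge0.
    have -> : 2 * (f q ^+ 2 + g q ^+ 2) - (f q - g q) ^+ 2 = (f q + g q) ^+ 2 by ring.
    exact: sqr_ge0.
  rewrite exprMn; have := key _ _ (sqr_ge0 (f q)) (sqr_ge0 (g q)).
  by generalize ((f q ^+ 2 + g q ^+ 2) ^+ 3) ((f q ^+ 2) ^+ 3 + (g q ^+ 2) ^+ 3) => a b; lra.
rewrite ge0_integralZl_EFin//.
- rewrite ge0_integralD//.
  + by rewrite lte_mul_pinfty// lte_add_pinfty.
  + by move=> q _; rewrite lee_fin.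
  + exact: m6.
  + by move=> q _; rewrite lee_fin.
  + exact: m6.
- by move=> q _; rewrite -EFinD lee_fin addr_ge0.
- by apply: emeasurable_funD; exact: m6.
Qed.

(** Nothing is known of [u] above the surface, so the derivative there is obtained as a limit: it
    vanishes at interior points, and those straight below (x, h x) come arbitrarily close. *)
Lemma derive_boundary_zero (u : R3 -> R) e x : smooth u ->
  (forall q, Dom h q -> u q = 0) -> derive u (x, h x) e = 0.
Proof.
move=> su u0.
have interior q : q.2 < h q.1 -> derive u q e = 0.
  move=> qh; rewrite -(derive_cst (0 : R) q e).
  apply: near_eq_derive.
  have n0 : 0 < h q.1 - q.2 by rewrite subr_gt0.
  have cz : continuous (fun q : R3 => h q.1 - q.2).
    move=> y; apply: cvgB; last exact: cvg_snd.
    by apply: (@continuous_comp _ _ _ fst h y); [exact: cvg_fst|exact: ch].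
  have /cvgrPdist_lt/(_ _ n0)/nbhs_normP[d /= d0 Hd] := cz q.
  apply/nbhs_normP; exists d => // y /= /Hd H.
  rewrite u0// /Dom /= -subr_ge0 ltW//.
  by have := le_lt_trans (ler_norm _) H; rewrite ltrBlDr ltrDl.
apply/eqP; rewrite -normr_le0 leNgt; apply/negP => n0.
have cD : continuous (fun q => derive u q e) by exact/smooth_continuous/smooth_derive.
have /cvgrPdist_lt/(_ _ n0)/nbhs_normP[d /= d0 Hd] := cD (x, h x).
have hd : h x - d / 2 < h x by rewrite gtrBl divr_gt0.
suff B : `|(x, h x) - (x, h x - d / 2)| < d.
  by have := Hd _ B; rewrite /= (interior (x, h x - d / 2) hd) subr0 ltxx.
rewrite (_ : (x, h x) - _ = (0, d / 2)); last by congr (_, _); rewrite /= ?subrr// subKr.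
rewrite prod_normE /= normr0 gt_max d0 /= gtr0_norm ?divr_gt0//; lra.
Qed.

(** Harmonic extensions are functions on all of R^3 and need not coincide above the surface; their
    gradients on it are nevertheless determined. *)
Lemma is_harm_ext_derive (F : R * R -> R) f g x e : is_harm_ext h F f -> is_harm_ext h F g ->
  derive f (x, h x) e = derive g (x, h x) e.
Proof.
move=> [sf [lf [Ff [f6 _]]]] [sg [lg [Fg [g6 _]]]].
pose u q := f q - g q.
have su : smooth u by move=> k; exact: CkB.
have dB (a b : R3 -> R) q e' : smooth a -> smooth b ->
    derive (fun q => a q - b q) q e' = derive a q e' - derive b q e'.
  by move=> sa sb; rewrite -deriveB//; apply: diff_derivable; exact: smooth_differentiable.
have lu q : Dom h q -> lap u q = 0.
  move=> qD; transitivity (lap f q - lap g q); last by rewrite lf// lg// subrr.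
  rewrite /lap -sumrB; apply: eq_bigr => i _; rewrite /pd3.
  rewrite (_ : (fun p => derive u p (e3 i)) = fun p => derive f p (e3 i) - derive g p (e3 i)).
    by apply: dB; exact: smooth_derive.
  by apply/funext => p; exact: dB.
have ub y : u (y, h y) = 0 by rewrite /u Ff Fg subrr.
have u6 : L6 (Dom h) u by apply: L6B => //; exact: smooth_continuous.
have u0 := harmonic_L6_zero ch su lu ub u6.
by have := derive_boundary_zero e x su u0; rewrite /u dB// => /eqP; rewrite subr_eq0 => /eqP.
Qed.

Lemma DtN_harm_ext (F : R * R -> R) f x : is_harm_ext h F f ->
  DtN h F x = Num.sqrt (1 + gradsq2 h x) * ndir h f x.
Proof.
move=> Hf; rewrite /DtN; congr (_ * _).
have He := @ClassicalEpsilon.epsilon_spec _ (inhabits (fun _ : R3 => (0 : R))) (is_harm_ext h F)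
  (ex_intro _ f Hf).
by rewrite /ndir; apply: eq_bigr => i _; congr (_ * _); exact: is_harm_ext_derive He Hf.
Qed.

End DirichletNeumann.

(** * Closed forms on the slab *)

Section Slices.
Context {R : realType} {V : normedModType R}.

(** Uncurrying turns time and space derivatives into directional derivatives along (1, 0) and (0,
    e), so that one chain rule and one symmetry theorem cover both. *)
Definition joint (f : R -> V -> R) (z : R * V) : R := f z.1 z.2.

Lemma slice_derive (f : R * V -> R) t y e :
  derive (fun y => f (t, y)) y e = derive f (t, y) (0, e).
Proof. by apply: derive_eq_quotient => k; congr (f (_, _)); rewrite /= scaler0 add0r. Qed.

Lemma slice_is_derive (f : R * V -> R) t y e df :
  is_derive (t, y) (0, e) f df -> is_derive y e (fun y => f (t, y)) df.
Proof. by apply: is_derive_eq_quotient => k; congr (f (_, _)); rewrite /= scaler0 add0r. Qed.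

Lemma time_is_derive (f : R * V -> R) (t : R) y df :
  is_derive (t, y) (1, 0) f df -> is_derive t 1 (fun t => f (t, y)) df.
Proof. by apply: is_derive_eq_quotient => k; congr (f (_, _)); rewrite /= scaler0 add0r. Qed.

Lemma time_derive (f : R * V -> R) (t : R) y :
  derive (fun t => f (t, y)) t 1 = derive f (t, y) (1, 0).
Proof. by apply: derive_eq_quotient => k; congr (f (_, _)); rewrite /= scaler0 add0r. Qed.

Lemma pair_continuous (t : R) : continuous (fun y : V => (t, y)).
Proof. by apply: continuous_pair => y; [exact: cvg_cst|exact: cvg_id]. Qed.

Lemma slice_differentiable (f : R * V -> R) t :
  (forall z, differentiable f z) -> forall y, differentiable (fun y => f (t, y)) y.
Proof.
move=> df y.
have dp : differentiable (fun y : V => (t, y)) y.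
  by apply: (@differentiable_pair _ _ _ _ (cst t) id) => //; exact: ex_diff.
exact: (@differentiable_comp _ _ _ _ (fun y : V => (t, y)) f).
Qed.

Lemma slice_continuous (f : R * V -> R) t : continuous f -> continuous (fun y => f (t, y)).
Proof.
by move=> cf y; apply: (@continuous_comp _ _ _ _ f y (@pair_continuous t y)); exact: cf.
Qed.

Lemma slice_Ck k (f : R * V -> R) t : Ck k f -> Ck k (fun y => f (t, y)).
Proof.
elim: k f => [|k IH] f /=; first exact: slice_continuous.
move=> [df cf]; split; first exact: slice_differentiable.
move=> u; have -> : (fun y => derive (fun y => f (t, y)) y u) =
    (fun y => derive f (t, y) (0, u)) by apply/funext => y; exact: slice_derive.
exact: (IH (fun z => derive f z (0, u)) (cf _)).
Qed.

Lemma slice_smooth (f : R -> V -> R) t : smooth_t f -> smooth (f t).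
Proof. by move=> sf k; exact: (slice_Ck t (sf k)). Qed.

End Slices.

Section Potentials.
Context {R : realType}.

Lemma derive_plane (f : R * R -> R) x (e : R * R) : differentiable f x ->
  derive f x e = e.1 * derive f x (e2 j0) + e.2 * derive f x (e2 j1).
Proof.
move=> df.
have E : e = e.1 *: e2 j0 + e.2 *: e2 j1 :> R * R.
  by case: e => a b; congr (_, _); rewrite /= -![_ *: _]/(_ * _); ring.
by rewrite [in LHS]E (@derive_comb _ _ f x _ _ _ _ df).
Qed.

Lemma derive_spacetime (f : R * (R * R) -> R) z (e : R * (R * R)) : differentiable f z ->
  derive f z e = e.1 * derive f z (1, 0) +
    (e.2.1 * derive f z (0, e2 j0) + e.2.2 * derive f z (0, e2 j1)).
Proof.
move=> df.
have E : e = e.1 *: (1, 0) + 1 *: (e.2.1 *: (0, e2 j0) + e.2.2 *: (0, e2 j1)) :> R * (R * R).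
  rewrite scale1r; case: e => a [b c].
  by congr (_, (_, _)); rewrite /= -![_ *: _]/(_ * _); ring.
rewrite [in LHS]E (@derive_comb _ _ f z _ _ _ _ df) mul1r.
by rewrite (@derive_comb _ _ f z _ _ _ _ df).
Qed.

Lemma C1_lin2 (V : normedModType R) (a b : R) (f g : V -> R) : Ck 1 f -> Ck 1 g ->
  Ck 1 (fun q => a * f q + b * g q).
Proof.
by move=> Cf Cg; exact: (C1D (C1M (C1_cst a) Cf) (C1M (C1_cst b) Cg)).
Qed.

Lemma derive_lin2 (V : normedModType R) (a b : R) (f g : V -> R) x u :
  differentiable f x -> differentiable g x ->
  derive (fun q => a * f q + b * g q) x u = a * derive f x u + b * derive g x u.
Proof.
move=> df dg.
have f1 : is_derive x u f (derive f x u) by apply: DeriveDef => //; exact: diff_derivable.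
have g1 : is_derive x u g (derive g x u) by apply: DeriveDef => //; exact: diff_derivable.
have fg : is_derive x u (fun q => a * f q + b * g q) (a * derive f x u + b * derive g x u).
  by apply: is_derive_eq.
by case: fg.
Qed.

(** Closedness along arbitrary directions is symmetry of the bilinear form given by the derivative
    of (U0, U1), for which one coordinate condition is enough. *)
Lemma plane_potential (U0 U1 : R * R -> R) : Ck 1 U0 -> Ck 1 U1 ->
  (forall x, derive U1 x (e2 j0) = derive U0 x (e2 j1)) ->
  exists a : R * R -> R, forall x e, is_derive x e a (e.1 * U0 x + e.2 * U1 x).
Proof.
move=> C0 C1 cl; pose W (q e : R * R) := e.1 * U0 q + e.2 * U1 q.
have Wlin q (a b : R) (u w : R * R) : W q (a *: u + b *: w) = a * W q u + b * W q w.
  by rewrite /W /= -![_ *: _]/(_ * _); ring.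
have WC1 e : Ck 1 (fun q => W q e) by exact: C1_lin2.
exists (fun q => \int[lebesgue_measure]_(s in `[0, 1]) W (0 + s *: (q - 0)) (q - 0)) => x e.
apply: (@Poincare_lemma R _ W 0 x Wlin WC1) => s e' _.
set y := x - 0; set q := 0 + _.
rewrite (derive_plane e' ((WC1 y).1 q)) (derive_plane y ((WC1 e').1 q)).
have dW u e1 : derive (fun q => W q u) q e1 = u.1 * derive U0 q e1 + u.2 * derive U1 q e1.
  exact: (derive_lin2 _ _ _ (C0.1 q) (C1.1 q)).
rewrite (dW y (e2 j0)) (dW y (e2 j1)) (dW e' (e2 j0)) (dW e' (e2 j1)) cl.
have alg (y0 y1 a0 a1 k l m : R) : a0 * (y0 * k + y1 * l) + a1 * (y0 * l + y1 * m) =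
    y0 * (a0 * k + a1 * l) + y1 * (a0 * l + a1 * m) by ring.
exact: alg.
Qed.

Lemma slab_potential (T0 T1 : R) (Q U0 U1 : R * (R * R) -> R) : T0 < T1 ->
  Ck 1 Q -> Ck 1 U0 -> Ck 1 U1 ->
  (forall z, T0 < z.1 < T1 -> [/\ derive U1 z (0, e2 j0) = derive U0 z (0, e2 j1),
    derive U0 z (1, 0) = derive Q z (0, e2 j0) & derive U1 z (1, 0) = derive Q z (0, e2 j1)]) ->
  exists a : R * (R * R) -> R, forall z e, T0 < z.1 < T1 ->
    is_derive z e a (e.1 * Q z + (e.2.1 * U0 z + e.2.2 * U1 z)).
Proof.
move=> T01 CQ C0 C1 cl.
(* The factor 1 gives [W] the shape of two nested combinations [C1_lin2]. *)
pose W (q e : R * (R * R)) := e.1 * Q q + 1 * (e.2.1 * U0 q + e.2.2 * U1 q).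
have Wlin q (a b : R) (u w : R * (R * R)) : W q (a *: u + b *: w) = a * W q u + b * W q w.
  by rewrite /W /= -![_ *: _]/(_ * _); ring.
have WC2 (e : R * (R * R)) : Ck 1 (fun q => e.2.1 * U0 q + e.2.2 * U1 q) by exact: C1_lin2.
have WC1 e : Ck 1 (fun q => W q e) by exact: (C1_lin2 _ _ CQ (WC2 e)).
pose z0 : R * (R * R) := ((T0 + T1) / 2, 0).
exists (fun q => \int[lebesgue_measure]_(s in `[0, 1]) W (z0 + s *: (q - z0)) (q - z0)) => z e zT.
rewrite (_ : _ + _ = W z e); last by rewrite /W mul1r.
apply: (@Poincare_lemma R _ W z0 z Wlin WC1) => s e' s01.
(* The slab is convex and [z0] lies at mid-time, so the segment never leaves the region where the
   form is closed. *)
have qT : T0 < (z0 + s *: (z - z0)).1 < T1.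
  rewrite /= -[_ *: _]/(_ * _).
  have -> : (T0 + T1) / 2 + s * (z.1 - (T0 + T1) / 2) = (1 - s) * ((T0 + T1) / 2) + s * z.1 by ring.
  move: zT s01 => /andP[z1 z2] /andP[s1 s2].
  have h1 : 0 <= (1 - s) * ((T1 - T0) / 2) by rewrite mulr_ge0//; lra.
  (* For s > 0 strictness comes from the time of [z]; at s = 0 it comes from the mid-time itself. *)
  have [sz|sz] := eqVneq s 0; first by rewrite sz; apply/andP; split; lra.
  have sp : 0 < s by rewrite lt_neqAle eq_sym sz.
  have h2 : 0 < s * (z.1 - T0) by rewrite mulr_gt0// subr_gt0.
  have h3 : 0 < s * (T1 - z.1) by rewrite mulr_gt0// subr_gt0.
  by apply/andP; split; lra.
set y := z - z0; set q := z0 + _ in qT *.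
have [c1 c2 c3] := cl q qT.
rewrite (derive_spacetime e' ((WC1 y).1 q)) (derive_spacetime y ((WC1 e').1 q)).
have dW u e1 : derive (fun q => W q u) q e1 =
    u.1 * derive Q q e1 + 1 * (u.2.1 * derive U0 q e1 + u.2.2 * derive U1 q e1).
  rewrite /W (derive_lin2 _ _ _ (CQ.1 q) ((WC2 u).1 q)).
  by rewrite (derive_lin2 _ _ _ (C0.1 q) (C1.1 q)).
rewrite (dW y (1, 0)) (dW y (0, e2 j0)) (dW y (0, e2 j1)).
rewrite (dW e' (1, 0)) (dW e' (0, e2 j0)) (dW e' (0, e2 j1)) c1 c2 c3.
have alg (y0 y1 y2 a0 a1 a2 k l m n o p' : R) :
    a0 * (y0 * k + 1 * (y1 * l + y2 * m)) + (a1 * (y0 * l + 1 * (y1 * n + y2 * o)) +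
      a2 * (y0 * m + 1 * (y1 * o + y2 * p'))) =
    y0 * (a0 * k + 1 * (a1 * l + a2 * m)) + (y1 * (a0 * l + 1 * (a1 * n + a2 * o)) +
      y2 * (a0 * m + 1 * (a1 * o + a2 * p'))) by ring.
exact: alg.
Qed.

End Potentials.

(** * Traces on the free surface *)

Lemma e3_jto3 (R : realType) (j : 'I_2) : e3 (jto3 j) = (e2 j, 0) :> (R * R) * R.
Proof. by case: j => [[|[|]]]. Qed.

Lemma e3_i2 (R : realType) : e3 i2 = (0, 1) :> (R * R) * R.
Proof. by []. Qed.

Section TangentialTrace.
Context {R : realType}.
Local Notation Z := (R * (R * R))%type.
Local Notation E := (R * ((R * R) * R))%type.
Variable H : Z -> R.
Hypothesis sH : smooth H.

Definition dx (i : 'I_3) (F : E -> R) (q : E) : R := derive F q (0, e3 i).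
Definition ds (F : E -> R) (q : E) : R := derive F q (1, 0).
Definition Hx (j : 'I_2) (z : Z) : R := derive H z (0, e2 j).
Definition Ht (z : Z) : R := derive H z (1, 0).

Lemma smooth_dx i F : smooth F -> smooth (dx i F).
Proof. exact: smooth_derive. Qed.

Lemma trace_dx (F : E -> R) (z : Z) (j : 'I_2) : smooth F ->
  is_derive z (0, e2 j) (on_graph F H)
    (on_graph (dx (jto3 j) F) H z + Hx j z * on_graph (dx i2 F) H z).
Proof.
move=> sF; have dF := smooth_differentiable sF; have dH := smooth_differentiable sH.
apply: DeriveDef; first by apply: diff_derivable; exact: on_graph_differentiable.
rewrite /dx e3_jto3 e3_i2; exact: (on_graph_derive dH dF).
Qed.

Lemma trace_ds (F : E -> R) (z : Z) : smooth F ->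
  is_derive z (1, 0) (on_graph F H)
    (on_graph (ds F) H z + Ht z * on_graph (dx i2 F) H z).
Proof.
move=> sF; have dF := smooth_differentiable sF; have dH := smooth_differentiable sH.
apply: DeriveDef; first by apply: diff_derivable; exact: on_graph_differentiable.
rewrite /dx e3_i2; exact: (on_graph_derive dH dF).
Qed.

Lemma Hx_is_derive j (z u : Z) : is_derive z u (Hx j) (derive (Hx j) z u).
Proof.
apply: DeriveDef => //; apply: diff_derivable.
exact: (smooth_differentiable (smooth_derive _ sH)).
Qed.

Lemma Ht_is_derive (z u : Z) : is_derive z u Ht (derive Ht z u).
Proof.
apply: DeriveDef => //; apply: diff_derivable.
exact: (smooth_differentiable (smooth_derive _ sH)).
Qed.

(* The horizontal components of a vector field [a], pulled back to R^2 along the graph. *)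
Definition tang (a : 'I_3 -> E -> R) (j : 'I_2) (z : Z) : R :=
  on_graph (a (jto3 j)) H z + Hx j z * on_graph (a i2) H z.

Variable a : 'I_3 -> E -> R.
Hypothesis sa : forall i, smooth (a i).

Lemma C1_tang j : Ck 1 (tang a j).
Proof.
have C (i : 'I_3) : Ck 1 (on_graph (a i) H) by exact: C1_on_graph.
have CH : Ck 1 (Hx j) by exact: (smooth_derive _ sH 1%N).
exact: (C1D (C _) (C1M CH (C _))).
Qed.

(** The derivatives [k] and [l] of the two traces stay abstract, so that one product rule serves
    space and time directions. *)
Lemma tang_derive j (z u : Z) k l : is_derive z u (on_graph (a (jto3 j)) H) k ->
  is_derive z u (on_graph (a i2) H) l ->
  derive (tang a j) z u = k + (derive (Hx j) z u * on_graph (a i2) H z + Hx j z * l).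
Proof.
move=> d1 d2; have d3 := Hx_is_derive j z u.
have D : is_derive z u (tang a j) (k + (derive (Hx j) z u * on_graph (a i2) H z + Hx j z * l)).
  rewrite /tang; apply: is_derive_eq; rewrite -![_ *: _]/(_ * _).
  have alg (A B C D' F : R) : A + (B * C + D' * F) = A + (F * D' + B * C) by ring.
  exact: alg.
by case: D.
Qed.

Lemma Hxx_sym (z : Z) : derive (Hx j1) z (0, e2 j0) = derive (Hx j0) z (0, e2 j1).
Proof. exact: (Schwarz _ _ _ (sH 2%N)). Qed.

Lemma Hxt_sym j (z : Z) : derive (Hx j) z (1, 0) = derive Ht z (0, e2 j).
Proof. exact: (Schwarz _ _ _ (sH 2%N)). Qed.

(** The second derivatives of [H] cancel by symmetry, and so do the two terms in the product of both
    slopes with the vertical derivative of [a i2]. What remains is the curl of [a] paired with (-∇H,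
    1). *)
Lemma tang_curl (z : Z) :
  derive (tang a j1) z (0, e2 j0) - derive (tang a j0) z (0, e2 j1) =
  (on_graph (dx i0 (a i1)) H z - on_graph (dx i1 (a i0)) H z)
  - Hx j0 z * (on_graph (dx i1 (a i2)) H z - on_graph (dx i2 (a i1)) H z)
  - Hx j1 z * (on_graph (dx i2 (a i0)) H z - on_graph (dx i0 (a i2)) H z).
Proof.
have J0 : jto3 j0 = i0 by exact: val_inj.
have J1 : jto3 j1 = i1 by exact: val_inj.
have d01 := trace_dx z j0 (sa i1); have d02 := trace_dx z j0 (sa i2).
have d10 := trace_dx z j1 (sa i0); have d12 := trace_dx z j1 (sa i2).
rewrite J0 in d01 d02; rewrite J1 in d10 d12.
have X1 := @tang_derive j1 z (0, e2 j0); rewrite J1 in X1.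
have {}X1 := X1 _ _ d01 d02.
have X2 := @tang_derive j0 z (0, e2 j1); rewrite J0 in X2.
have {}X2 := X2 _ _ d10 d12.
rewrite Hxx_sym in X1.
have alg (a01 a21 h0 a02 a22 h1 a10 a20 a12 H2 V2 : R) :
  a10 + h0 * a12 + (H2 * V2 + h1 * (a20 + h0 * a22)) -
   (a01 + h1 * a02 + (H2 * V2 + h0 * (a21 + h1 * a22))) =
  a10 - a01 - h0 * (a21 - a12) - h1 * (a02 - a20) by ring.
exact: (etrans (congr2 (fun x y => x - y) X1 X2) (alg _ _ _ _ _ _ _ _ _ _ _)).
Qed.

End TangentialTrace.

(* [a_kl] stands for ∂_l v_k and [a_kt] for ∂_t v_k on the surface (indices from 0), [h0t] for
   ∂_0 ∂_t h; the last hypothesis is the vanishing of the normal vorticity. *)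
Lemma momentum_balance (R : realType) (h0 h1 ht h0t v0 v1 v2 a0t a2t
    a00 a01 a02 a10 a12 a20 a21 a22 p0 p2 : R) :
  ht + v0 * h0 + v1 * h1 = v2 ->
  a0t + (v0 * a00 + v1 * a01 + v2 * a02) = - p0 ->
  a2t + (v0 * a20 + v1 * a21 + v2 * a22) = - p2 - 1 ->
  p0 + h0 * p2 = 0 ->
  (a10 - a01) + h0 * (a12 - a21) + h1 * (a20 - a02) = 0 ->
  a0t + ht * a02 + (h0t * v2 + h0 * (a2t + ht * a22)) =
  - h0 - (v0 * (a00 + h0 * a02) + v1 * (a10 + h0 * a12) + v2 * (a20 + h0 * a22)) +
    ((a20 + h0 * a22) * ht + v2 * h0t).
Proof.
move=> kin E0 E2 pr cu.
have {kin} -> : ht = v2 - v0 * h0 - v1 * h1 by rewrite -kin; ring.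
have {E0} -> : a0t = - p0 - (v0 * a00 + v1 * a01 + v2 * a02) by rewrite -E0; ring.
have {E2} -> : a2t = - p2 - 1 - (v0 * a20 + v1 * a21 + v2 * a22) by rewrite -E2; ring.
have {pr} -> : p0 = - (h0 * p2) by apply/eqP; rewrite -addr_eq0 pr.
apply/eqP; rewrite -subr_eq0; apply/eqP.
(* Once the equations have eliminated ∂_t h, the accelerations and the tangential pressure gradient,
   the two sides differ by the transverse velocity times the normal vorticity. *)
transitivity (v1 * ((a10 - a01) + h0 * (a12 - a21) + h1 * (a20 - a02))); first by ring.
by rewrite cu mulr0.
Qed.

(* [s_i] stands for ∂_i ψ on the surface. *)
Lemma Bernoulli_rearranged (R : realType) (h h0 h1 ht v0 v1 v2 s0 s1 s2 : R) :
  ht + v0 * h0 + v1 * h1 = v2 ->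
  ht = s2 - h0 * s0 - h1 * s1 ->
  - h - (1 / 2) * (v0 * v0 + v1 * v1 + v2 * v2) + v2 * ht =
  - h - (1 / 2) * ((s0 + h0 * s2) ^+ 2 + (s1 + h1 * s2) ^+ 2)
  + (1 / 2) * (ht + (h0 * (s0 + h0 * s2) + h1 * (s1 + h1 * s2))) ^+ 2 / (1 + (h0 ^+ 2 + h1 ^+ 2))
  + (- (1 / 2) * ((v0 - s0) ^+ 2 + (v1 - s1) ^+ 2)
     - ((s0 + h0 * s2) * (v0 - s0) + (s1 + h1 * s2) * (v1 - s1))
     - (1 / 2) * ((v0 - s0) * h0 + (v1 - s1) * h1) ^+ 2
     + ht * ((v0 - s0) * h0 + (v1 - s1) * h1)).
Proof.
move=> <- ->.
have n0 : 1 + (h0 ^+ 2 + h1 ^+ 2) != 0 :> R.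
  by rewrite gt_eqF// ltr_pwDl// addr_ge0// sqr_ge0.
have sqE (n : R) : n != 0 -> (1 / 2) * (s2 * n) ^+ 2 / n = (1 / 2) * (s2 * s2) * n.
  by move=> nz; field.
(* G(h)φ + ∇h.∇φ equals (1 + |∇h|^2) ∂_3 ψ, so the quotient in the Bernoulli equation is a
   polynomial in disguise. *)
have -> : s2 - h0 * s0 - h1 * s1 + (h0 * (s0 + h0 * s2) + h1 * (s1 + h1 * s2)) =
  s2 * (1 + (h0 ^+ 2 + h1 ^+ 2)) by ring.
by rewrite sqE//; field.
Qed.

(** * The vorticity identity, the potentials and the evolution on the surface *)

Section Assembly.
Context {R : realType}.
Local Notation Z := (R * (R * R))%type.
Local Notation E := (R * ((R * R) * R))%type.
Variables (h : R -> R * R -> R) (v : 'I_3 -> R -> (R * R) * R -> R)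
  (p : R -> (R * R) * R -> R) (psi : R -> (R * R) * R -> R).
Hypotheses (sh : smooth_t h) (sv : forall i, smooth_t (v i)) (sp : smooth_t p)
  (spsi : smooth_t psi).

Let H : Z -> R := joint h.
Let V (i : 'I_3) : E -> R := joint (v i).
Let Ps : E -> R := joint psi.
Let Pp : E -> R := joint p.
Let VO (i : 'I_3) (q : E) : R := V i q - dx i Ps q.

Let sH : smooth H. Proof. exact: sh. Qed.
Let sV i : smooth (V i). Proof. exact: sv. Qed.
Let sPs : smooth Ps. Proof. exact: spsi. Qed.
Let sPp : smooth Pp. Proof. exact: sp. Qed.
Let sVO i : smooth (VO i).
Proof. by move=> k; apply: CkB; [exact: sV|exact: (smooth_dx i sPs)]. Qed.

Lemma pd2_joint j t x : pd2 j (h t) x = Hx H j (t, x).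
Proof. exact: (slice_derive H t x (e2 j)). Qed.

Lemma pd3_joint (f : R -> (R * R) * R -> R) i t q : pd3 i (f t) q = dx i (joint f) (t, q).
Proof. exact: (slice_derive (joint f) t q (e3 i)). Qed.

Lemma dt_joint (f : R -> (R * R) * R -> R) t q : dt f t q = ds (joint f) (t, q).
Proof. exact: (time_derive (joint f) t q). Qed.

Lemma dt_height t x : dt h t x = Ht H (t, x).
Proof. exact: (time_derive H t x). Qed.

Lemma Uom_tang j t x : Uom v psi h j t x = tang H VO j (t, x).
Proof. by rewrite /Uom /Vom /Bom /vom !(pd3_joint psi) pd2_joint. Qed.

Lemma pd2_tang (a : 'I_3 -> E -> R) i j t x :
  pd2 j (fun x => tang H a i (t, x)) x = derive (tang H a i) (t, x) (0, e2 j).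
Proof. exact: (slice_derive (tang H a i) t x (e2 j)). Qed.

Lemma dx_VO_curl i k q : dx k (VO i) q - dx i (VO k) q = dx k (V i) q - dx i (V k) q.
Proof.
have D k' i' : dx k' (VO i') q = dx k' (V i') q - dx k' (dx i' Ps) q.
  rewrite /dx -deriveB //; apply: diff_derivable.
    exact: (smooth_differentiable (sV i')).
  exact: (smooth_differentiable (smooth_dx i' sPs)).
have S : dx k (dx i Ps) q = dx i (dx k Ps) q by exact: (Schwarz _ _ _ (sPs 2%N)).
by rewrite !D S opprB addrA subrK.
Qed.

Definition normal_vorticity t x : R :=
  omega v t i2 (x, h t x) - pd2 j0 (h t) x * omega v t i0 (x, h t x)
    - pd2 j1 (h t) x * omega v t i1 (x, h t x).

Lemma normal_vorticity_joint t x : normal_vorticity t x =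
  (dx i0 (V i1) (t, (x, h t x)) - dx i1 (V i0) (t, (x, h t x)))
  - Hx H j0 (t, x) * (dx i1 (V i2) (t, (x, h t x)) - dx i2 (V i1) (t, (x, h t x)))
  - Hx H j1 (t, x) * (dx i2 (V i0) (t, (x, h t x)) - dx i0 (V i2) (t, (x, h t x))).
Proof. by rewrite /normal_vorticity /omega /curl /= !pd2_joint !(pd3_joint (v _)). Qed.

Lemma tang_V_curl t x :
  derive (tang H V j1) (t, x) (0, e2 j0) - derive (tang H V j0) (t, x) (0, e2 j1) =
  normal_vorticity t x.
Proof. by rewrite normal_vorticity_joint (tang_curl sH sV). Qed.

Lemma tang_VO_curl t x :
  derive (tang H VO j1) (t, x) (0, e2 j0) - derive (tang H VO j0) (t, x) (0, e2 j1) =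
  normal_vorticity t x.
Proof.
rewrite normal_vorticity_joint; set q := (t, (x, h t x)).
apply: (etrans (tang_curl sH sVO (t, x))).
exact: (f_equal3 (fun a b c => a - Hx H j0 (t, x) * b - Hx H j1 (t, x) * c)
  (dx_VO_curl i1 i0 q) (dx_VO_curl i2 i1 q) (dx_VO_curl i0 i2 q)).
Qed.

Lemma Uom_curl t x : pd2 j0 (Uom v psi h j1 t) x - pd2 j1 (Uom v psi h j0 t) x =
  normal_vorticity t x.
Proof.
have -> : Uom v psi h j1 t = fun x => tang H VO j1 (t, x) by apply/funext => y; exact: Uom_tang.
have -> : Uom v psi h j0 t = fun x => tang H VO j0 (t, x) by apply/funext => y; exact: Uom_tang.
by rewrite !pd2_tang tang_VO_curl.
Qed.

Let area t x : R := Num.sqrt (1 + gradsq2 (h t) x).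

Let area_neq0 t x : area t x != 0.
Proof. by rewrite sqrtr_eq0 -ltNge ltr_pwDl// addr_ge0// sqr_ge0. Qed.

Lemma sum_nrm (f : 'I_3 -> R) t x : area t x * (\sum_(i < 3) f i * nrm (h t) x i) =
  f i2 - pd2 j0 (h t) x * f i0 - pd2 j1 (h t) x * f i1.
Proof.
rewrite sum_ord3 /nrm /= -/(area t x).
have -> : inord 0 = j0 :> 'I_2 by apply: val_inj; rewrite /= inordK.
have -> : inord 1 = j1 :> 'I_2 by apply: val_inj; rewrite /= inordK.
by field; exact: area_neq0.
Qed.

Lemma normal_vorticityE t x : normal_vorticity t x = area t x * omega_n v h t x.
Proof. by rewrite /omega_n (sum_nrm (fun i => omega v t i (x, h t x))). Qed.

Lemma potential_fixed_time t : (forall x, omega_n v h t x = 0) ->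
  exists a : R * R -> R, (forall x, differentiable a x) /\
    (forall j x, pd2 j a x = Uom v psi h j t x).
Proof.
move=> on0.
pose U j x := tang H VO j (t, x).
have CU j : Ck 1 (U j) by exact: (slice_Ck t (C1_tang sH sVO j)).
have cl x : derive (U j1) x (e2 j0) = derive (U j0) x (e2 j1).
  have := tang_VO_curl t x; rewrite normal_vorticityE on0 mulr0 => /eqP.
  by rewrite subr_eq0 => /eqP E1; exact: (etrans (slice_derive (tang H VO j1) t x (e2 j0))
    (etrans E1 (esym (slice_derive (tang H VO j0) t x (e2 j1))))).
have [a Ha] := plane_potential (CU j0) (CU j1) cl.
exists a; split.
  by move=> x; exact: (continuous_partials_differentiable
    (C1_continuous (CU j0)) (C1_continuous (CU j1)) Ha).
move=> j x; rewrite Uom_tang -/(U j x); have [_ E1] := Ha x (e2 j).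
by rewrite /pd2 E1; case: j {E1} => [[|[|]]] //= i;
  rewrite ?(mul1r, mul0r, addr0, add0r); congr (U _ x); exact: val_inj.
Qed.


(* On the surface, with the kinematic condition, this is the right-hand side of the
   Bernoulli equation of part (2). *)
Definition bernoulli (z : Z) : R :=
  (- 1) * H z + (- (1 / 2)) * (on_graph (V i0) H z * on_graph (V i0) H z +
    on_graph (V i1) H z * on_graph (V i1) H z + on_graph (V i2) H z * on_graph (V i2) H z) +
  on_graph (V i2) H z * Ht H z.

Lemma C1_bernoulli : Ck 1 bernoulli.
Proof.
have C i : Ck 1 (on_graph (V i) H) by exact: C1_on_graph.
have S i := C1M (C i) (C i).
have CHt : Ck 1 (Ht H) by exact: (smooth_derive _ sH 1%N).
exact: (C1D (C1D (C1M (C1_cst _) (sH 1%N)) (C1M (C1_cst _) (C1D (C1D (S i0) (S i1)) (S i2))))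
  (C1M (C i2) CHt)).
Qed.

Lemma bernoulli_derive (z u : Z) dh d0 d1 d2 dht : is_derive z u H dh ->
  is_derive z u (on_graph (V i0) H) d0 -> is_derive z u (on_graph (V i1) H) d1 ->
  is_derive z u (on_graph (V i2) H) d2 -> is_derive z u (Ht H) dht ->
  derive bernoulli z u = - dh - (on_graph (V i0) H z * d0 + on_graph (V i1) H z * d1 +
    on_graph (V i2) H z * d2) + (d2 * Ht H z + on_graph (V i2) H z * dht).
Proof.
move=> Dh D0 D1 D2 Dt.
have alg (a0 a1 a2 b : R) : (- 1) * dh + (- (1 / 2)) * (a0 * d0 + a0 * d0 + (a1 * d1 + a1 * d1) +
   (a2 * d2 + a2 * d2)) + (a2 * dht + b * d2) =
   - dh - (a0 * d0 + a1 * d1 + a2 * d2) + (d2 * b + a2 * dht) by field.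
have D : is_derive z u bernoulli (- dh - (on_graph (V i0) H z * d0 + on_graph (V i1) H z * d1 +
    on_graph (V i2) H z * d2) + (d2 * Ht H z + on_graph (V i2) H z * dht)).
  by rewrite /bernoulli; apply: is_derive_eq; rewrite -![_ *: _]/(_ * _); exact: alg.
by case: D.
Qed.

Section FixedTime.
Variable t : R.
Hypothesis euler : forall q, Dom (h t) q -> forall i : 'I_3,
  dt (v i) t q + \sum_(k < 3) v k t q * pd3 k (v i t) q
    = - pd3 i (p t) q - (if i == i2 then 1 else 0).
Hypothesis kin : forall x : R * R,
  dt h t x + v i0 t (x, h t x) * pd2 j0 (h t) x + v i1 t (x, h t x) * pd2 j1 (h t) x
    = v i2 t (x, h t x).
Hypothesis dyn : forall x : R * R, p t (x, h t x) = 0.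
Hypothesis harm : forall q, Dom (h t) q -> lap (psi t) q = 0.
Hypothesis neumann : forall x, ndir (h t) (psi t) x = \sum_(i < 3) v i t (x, h t x) * nrm (h t) x i.
Hypothesis psi6 : L6 (Dom (h t)) (psi t).
Hypothesis psiH : Hdot1 (Dom (h t)) (psi t).

Let tr i x := on_graph (V i) H (t, x).

Lemma kin_joint x : Ht H (t, x) + tr i0 x * Hx H j0 (t, x) + tr i1 x * Hx H j1 (t, x) = tr i2 x.
Proof. by rewrite -dt_height -!pd2_joint; exact: kin. Qed.

Lemma euler_joint i x : on_graph (ds (V i)) H (t, x) +
  (tr i0 x * on_graph (dx i0 (V i)) H (t, x) + tr i1 x * on_graph (dx i1 (V i)) H (t, x) +
   tr i2 x * on_graph (dx i2 (V i)) H (t, x)) =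
  - on_graph (dx i Pp) H (t, x) - (if i == i2 then 1 else 0).
Proof.
have qD : Dom (h t) (x, h t x) by rewrite /Dom /=.
have := euler qD i; rewrite sum_ord3 dt_joint !(pd3_joint (v i)) (pd3_joint p).
exact.
Qed.

(** The left side is the derivative along the surface of p(t, x, h(t, x)), which is identically
    0. *)
Lemma pressure_tangential j x :
  on_graph (dx (jto3 j) Pp) H (t, x) + Hx H j (t, x) * on_graph (dx i2 Pp) H (t, x) = 0.
Proof.
have [_ <-] := trace_dx sH (t, x) j sPp.
rewrite -slice_derive -(derive_cst (0 : R) x (e2 j)); congr (derive _ x _).
by apply/funext => y; exact: dyn.
Qed.

Lemma bernoulli_closed j x : normal_vorticity t x = 0 ->
  derive (tang H V j) (t, x) (1, 0) = derive bernoulli (t, x) (0, e2 j).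
Proof.
move=> nv; set z := (t, x).
have D i := trace_ds sH z (sV i).
have Dx i := trace_dx sH z j (sV i).
have Dh : is_derive z (0, e2 j) H (Hx H j z).
  by apply: DeriveDef => //; apply: diff_derivable; exact: smooth_differentiable.
have X1 := tang_derive sH (D (jto3 j)) (D i2); rewrite (Hxt_sym sH) in X1.
have X2 := bernoulli_derive Dh (Dx i0) (Dx i1) (Dx i2) (Ht_is_derive sH z (0, e2 j)).
apply: (etrans X1); apply: etrans (esym X2); clear X1 X2.
have K := kin_joint x; have E2 := euler_joint i2 x; rewrite eqxx in E2.
have P := pressure_tangential j x.
(* These two bring the vanishing normal vorticity into the form required by [momentum_balance], the
   second with the horizontal indices exchanged and hence with opposite sign. *)
have sgn (a b c d e f k l : R) : a - b - k * (c - d) - l * (e - f) = 0 ->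
    a - b + k * (d - c) + l * (f - e) = 0 by move=> <-; ring.
have sgn' (a b c d e f k l : R) : a - b - k * (c - d) - l * (e - f) = 0 ->
    b - a + l * (e - f) + k * (c - d) = 0 by move=> E0; apply: oppr_inj; rewrite oppr0 -E0; ring.
rewrite normal_vorticity_joint in nv.
case: j P {D Dx Dh} => [[|[|//]]] jP P.
- have J0 : Ordinal jP = j0 by exact: val_inj.
  have J : jto3 j0 = i0 by exact: val_inj.
  have E0 := euler_joint i0 x; rewrite (_ : (i0 == i2) = false) // subr0 in E0.
  rewrite J0 J in P *.
  exact: (momentum_balance _ K E0 E2 P (sgn _ _ _ _ _ _ _ _ nv)).
have J1 : Ordinal jP = j1 by exact: val_inj.
have J : jto3 j1 = i1 by exact: val_inj.
have E1 := euler_joint i1 x; rewrite (_ : (i1 == i2) = false) // subr0 in E1.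
rewrite J1 J in P *.
(* For the second component [momentum_balance] is applied with the roles of the two horizontal
   directions swapped; the sums are reordered to match. *)
rewrite addrAC in K; rewrite (addrC (tr i0 x * _)) in E1; rewrite (addrC (tr i0 x * _)) in E2.
apply: (etrans (momentum_balance _ K E1 E2 P (sgn' _ _ _ _ _ _ _ _ nv))).
have alg (a b c d e : R) : - a - (b + c + d) + e = - a - (c + b + d) + e by ring.
exact: alg.
Qed.

Lemma psi_harm_ext : is_harm_ext (h t) (phi psi h t) (psi t).
Proof. by do ?split; [exact: (slice_smooth t spsi)|exact: harm|exact: psi6|exact: psiH]. Qed.

Lemma height_continuous : continuous (h t).
Proof. exact: (smooth_continuous (slice_smooth t sh)). Qed.

(** The kinematic condition says that ∂_t h is sqrt(1 + |∇h|^2) v.n, and the Neumann condition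
    replaces v.n by the normal derivative of ψ. *)
Lemma dt_height_DtN x : dt h t x = DtN (h t) (phi psi h t) x.
Proof.
rewrite (DtN_harm_ext height_continuous x psi_harm_ext) neumann.
rewrite (sum_nrm (fun i => v i t (x, h t x))) -(kin x).
have alg (a b c d e : R) : a = a + b * c + d * e - c * b - e * d by ring.
exact: alg.
Qed.

Lemma normal_psi x : dt h t x = on_graph (dx i2 Ps) H (t, x)
  - Hx H j0 (t, x) * on_graph (dx i0 Ps) H (t, x) - Hx H j1 (t, x) * on_graph (dx i1 Ps) H (t, x).
Proof.
rewrite dt_height_DtN (DtN_harm_ext height_continuous x psi_harm_ext).
have E1 : ndir (h t) (psi t) x = \sum_(i < 3) pd3 i (psi t) (x, h t x) * nrm (h t) x i.
  by apply: eq_bigr => i _; rewrite mulrC.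
rewrite E1 (sum_nrm (fun i => pd3 i (psi t) (x, h t x))) !(pd3_joint psi) !pd2_joint.
by [].
Qed.

Lemma pd2_phi j x : pd2 j (phi psi h t) x =
  on_graph (dx (jto3 j) Ps) H (t, x) + Hx H j (t, x) * on_graph (dx i2 Ps) H (t, x).
Proof.
have [_ <-] := trace_dx sH (t, x) j sPs.
exact: (slice_derive (on_graph Ps H) t x (e2 j)).
Qed.

Lemma bernoulliE x : bernoulli (t, x) =
  - h t x - (1 / 2) * gradsq2 (phi psi h t) x
  + (1 / 2) * (DtN (h t) (phi psi h t) x
       + (pd2 j0 (h t) x * pd2 j0 (phi psi h t) x
          + pd2 j1 (h t) x * pd2 j1 (phi psi h t) x)) ^+ 2 / (1 + gradsq2 (h t) x)
  + Rom v psi h t x.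
Proof.
have J0 : jto3 j0 = i0 by exact: val_inj.
have J1 : jto3 j1 = i1 by exact: val_inj.
have N := normal_psi x; have K := kin_joint x.
rewrite /Rom /gradsq2 -!dt_height_DtN /Vom /vom !pd2_phi !(pd3_joint psi) !pd2_joint.
rewrite J0 J1 dt_height in N *.
have B := Bernoulli_rearranged (h t x) K N.
apply: etrans B.
have alg (a b c : R) : (- 1) * a + (- (1 / 2)) * b + c = - a - (1 / 2) * b + c by ring.
exact: alg.
Qed.

End FixedTime.
End Assembly.

Unset Implicit Arguments. Set Strict Implicit.
Theorem theorem3p1 (R : realType) (T0 T1 : R)
  (h : R -> R * R -> R) (v : 'I_3 -> R -> (R * R) * R -> R)
  (p : R -> (R * R) * R -> R) (psi : R -> (R * R) * R -> R) :
  T0 < T1 ->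
  (* sufficiently smooth *)
  smooth_t h -> (forall i, smooth_t (v i)) -> smooth_t p -> smooth_t psi ->
  (* decay at spatial infinity *)
  (forall t, T0 < t < T1 -> forall e : R, 0 < e -> exists M : R, forall x : R * R,
     M < `|x| -> `|h t x| < e /\ (forall j, `|pd2 j (h t) x| < e)) ->
  (forall t, T0 < t < T1 -> forall e : R, 0 < e -> exists M : R,
     forall q : (R * R) * R, Dom (h t) q -> M < `|q| -> forall i, `|v i t q| < e) ->
  (* Euler equations with gravity in D_t *)
  (forall t, T0 < t < T1 -> forall q, Dom (h t) q -> forall i : 'I_3,
     dt (v i) t q + \sum_(k < 3) v k t q * pd3 k (v i t) q
       = - pd3 i (p t) q - (if i == i2 then 1 else 0)) ->
  (forall t, T0 < t < T1 -> forall q, Dom (h t) q -> \sum_(i < 3) pd3 i (v i t) q = 0) ->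
  (* kinematic and dynamic boundary conditions *)
  (forall t, T0 < t < T1 -> forall x : R * R,
     dt h t x + v i0 t (x, h t x) * pd2 j0 (h t) x + v i1 t (x, h t x) * pd2 j1 (h t) x
       = v i2 t (x, h t x)) ->
  (forall t, T0 < t < T1 -> forall x : R * R, p t (x, h t x) = 0) ->
  (* psi : harmonic in D_t, Neumann data v.n, psi in L^6 cap dot-H^1 *)
  (forall t, T0 < t < T1 ->
     (forall q, Dom (h t) q -> lap (psi t) q = 0) /\
     (forall x, ndir (h t) (psi t) x = \sum_(i < 3) v i t (x, h t x) * nrm (h t) x i) /\
     L6 (Dom (h t)) (psi t) /\ Hdot1 (Dom (h t)) (psi t)) ->
  (* (1) *)
  (forall t, T0 < t < T1 ->
     (forall x : R * R,
        pd2 j0 (Uom v psi h j1 t) x - pd2 j1 (Uom v psi h j0 t) x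
          = omega v t i2 (x, h t x) - pd2 j0 (h t) x * omega v t i0 (x, h t x)
              - pd2 j1 (h t) x * omega v t i1 (x, h t x) /\
        omega v t i2 (x, h t x) - pd2 j0 (h t) x * omega v t i0 (x, h t x)
              - pd2 j1 (h t) x * omega v t i1 (x, h t x)
          = Num.sqrt (1 + gradsq2 (h t) x) * omega_n v h t x) /\
     ((forall x, omega_n v h t x = 0) ->
        exists a : R * R -> R, (forall x, differentiable a x) /\
          (forall j x, pd2 j a x = Uom v psi h j t x))) /\
  (* (2) *)
  ((forall t, T0 < t < T1 -> forall x, omega_n v h t x = 0) ->
     (forall t, T0 < t < T1 -> forall x, dt h t x = DtN (h t) (phi psi h t) x) /\
     exists a : R -> R * R -> R, forall t, T0 < t < T1 ->
       (forall x, differentiable (a t) x) /\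
       (forall j x, pd2 j (a t) x = Uom v psi h j t x) /\
       (forall x,
          derivable (fun s : R => phi psi h s x + a s x) t 1 /\
          dt (fun s y => phi psi h s y + a s y) t x
            = - h t x - (1 / 2) * gradsq2 (phi psi h t) x
              + (1 / 2) * (DtN (h t) (phi psi h t) x
                   + (pd2 j0 (h t) x * pd2 j0 (phi psi h t) x
                      + pd2 j1 (h t) x * pd2 j1 (phi psi h t) x)) ^+ 2
                / (1 + gradsq2 (h t) x)
              + Rom v psi h t x)).
Proof.
move=> T01 sh sv sp spsi _ _ euler div kin dyn psiE.
split.
  move=> t tT; split.
    move=> x; split; first exact: (Uom_curl sh sv spsi t x).
    exact: (normal_vorticityE h v t x).
  move=> on0; exact: (potential_fixed_time sh sv spsi on0).
move=> on0.
have G t (tT : T0 < t < T1) x : dt h t x = DtN (h t) (phi psi h t) x.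
  have [harm [neu [l6 h1]]] := psiE t tT.
  exact: (dt_height_DtN sh spsi (kin t tT) harm neu l6 h1).
split=> //.
pose H : R * (R * R) -> R := joint h.
pose V i : R * ((R * R) * R) -> R := joint (v i).
have nv t x : T0 < t < T1 -> normal_vorticity h v t x = 0.
  by move=> tT; rewrite normal_vorticityE (on0 t tT) mulr0.
have closed z : T0 < z.1 < T1 -> [/\
    derive (tang H V j1) z (0, e2 j0) = derive (tang H V j0) z (0, e2 j1),
    derive (tang H V j0) z (1, 0) = derive (bernoulli h v) z (0, e2 j0) &
    derive (tang H V j1) z (1, 0) = derive (bernoulli h v) z (0, e2 j1)].
  case: z => t x tT.
  have B j := bernoulli_closed sh sv sp (euler t tT) (kin t tT) (dyn t tT) j (nv t x tT).
  split; [|exact: (B j0)|exact: (B j1)].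
  by apply/eqP; rewrite -subr_eq0; apply/eqP; apply: (etrans (tang_V_curl sh sv t x)); exact: nv.
have [A HA] := slab_potential T01 (C1_bernoulli sh sv) (C1_tang sh sv j0) (C1_tang sh sv j1) closed.
(* The additive constant at each time is the one inherited from the single potential [A] on the
   slab. *)
exists (fun t x => A (t, x) - phi psi h t x) => t tT.
have HAt x (e : R * R) : is_derive x e (fun x => A (t, x))
    (e.1 * tang H V j0 (t, x) + e.2 * tang H V j1 (t, x)).
  apply: slice_is_derive; have D := HA (t, x) (0, e) tT.
  by rewrite mul0r add0r in D.
have dphi x : differentiable (phi psi h t) x.
  have := on_graph_differentiable (smooth_differentiable sh) (smooth_differentiable spsi).
  by move=> dg; exact: (slice_differentiable t dg x).
have cT j : continuous (fun x => tang H V j (t, x)).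
  exact: (@slice_continuous _ _ (tang H V j) t (@C1_continuous _ _ _ (C1_tang sh sv j))).
have dA x : differentiable (fun x => A (t, x)) x.
  exact: (continuous_partials_differentiable (cT j0) (cT j1) HAt).
split; first by move=> x; exact: differentiableB.
split.
  move=> j x; rewrite /pd2 deriveB; [|exact: diff_derivable|exact: diff_derivable].
  have [_ ->] := HAt x (e2 j).
  rewrite -[X in _ - X]/(pd2 j (phi psi h t) x) (pd2_phi sh spsi) Uom_tang.
  have -> : (e2 j).1 * tang H V j0 (t, x) + (e2 j).2 * tang H V j1 (t, x) = tang H V j (t, x).
    case: j => [[|[|]]] //= i; rewrite ?(mul1r, mul0r, addr0, add0r);
      by congr (tang H V _ (t, x)); exact: val_inj.
  have alg (a b c d k : R) : a + k * b - (c + k * d) = (a - c) + k * (b - d) by ring.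
  exact: alg.
move=> x.
(* φ cancels in φ + a, so the evolution equation is exactly the time component of dA. *)
have E : (fun s => phi psi h s x + (A (s, x) - phi psi h s x)) = (fun s => A (s, x)).
  by apply/funext => s; rewrite addrC subrK.
have D : is_derive t 1 (fun s => A (s, x)) (bernoulli h v (t, x)).
  have alg (q a b : R) : 1 * q + (0 * a + 0 * b) = q by ring.
  by apply: time_is_derive; exact: (is_derive_eq (HA (t, x) (1, 0) tT) (alg _ _ _)).
rewrite /dt E; have [D1 D2] := D; split; first exact: D1.
have [harm [neu [l6 h1]]] := psiE t tT.
rewrite D2; exact: (bernoulliE sh spsi (kin t tT) harm neu l6 h1 x).
Qed.
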